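(* Let $r\ge 1$ and let $A\in\mathcal{M}_r$, $R,S\in\mathcal{S}_r^0$ be such that $(A,S^{1/2})$ is observable and $(A,R^{1/2})$ is controllable. Below, $c<\infty$ denotes some parameter whose value depends on the matrices $(A,R,S)$ and may change from line to line. For any $s,t\ge0$ and any $Q\in\mathcal{S}_r^0$ one has $$\Vert E_{s,s+t}(Q)\Vert\le c\,(1+\Vert Q\Vert)\,\Vert E_t(P_\infty)\Vert .$$ In addition, for any $t\ge0$ and $s\ge\delta>0$ one has the uniform estimates $$\sup_{Q\in\mathcal{S}_r^0}\Vert E_{s,s+t}(Q)\Vert\le c\,\Vert E_t(P_\infty)\Vert\qquad\text{and}\qquad \sup_{Q\in\mathcal{S}_r^0}\Vert E_{t,t+s}(Q)\Vert\le\chi_\delta\,\Vert E_s(P_\infty)\Vert,$$ where $\chi_\delta:=\left[\lambda_{\min}(\mathbb{S}_\delta)\,\lambda_{\min}(-P_\infty^-)\right]^{-1}$.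
   Context: Notation: $\mathcal{M}_r=\mathbb{R}^{r\times r}$; $\mathcal{S}_r^0$ and $\mathcal{S}_r^+$ are the sets of real symmetric positive semi-definite, respectively positive definite, $r\times r$ matrices; $A'$ is the transpose of $A$; $\Vert\cdot\Vert$ is the spectral norm; $\lambda_{\min}$ is the smallest eigenvalue of a symmetric matrix. $S^{1/2},R^{1/2}$ are symmetric square roots. Observability of $(A,S^{1/2})$ means that the matrix obtained by stacking $S^{1/2},S^{1/2}A,\dots,S^{1/2}A^{r-1}$ has rank $r$; controllability of $(A,R^{1/2})$ means that $[R^{1/2},AR^{1/2},\dots,A^{r-1}R^{1/2}]$ has rank $r$. Riccati flow: $\Lambda(P):=AP+PA'+R-PSP$. For $Q\in\mathcal{S}_r^0$, $t\mapsto\phi_t(Q)\in\mathcal{S}_r^0$, $t\ge 0$, is the (globally defined) solution of $\partial_t\phi_t(Q)=\Lambda(\phi_t(Q))$, $\phi_0(Q)=Q$. Exponential semigroup: for $0\le s\le t$, $E_{s,t}(Q)$ is the solution of $\partial_tE_{s,t}(Q)=(A-\phi_t(Q)S)E_{s,t}(Q)$ with $E_{s,s}(Q)=I$; $E_t(Q):=E_{0,t}(Q)$. Fixed point: under the observability and controllability assumptions there is a unique $P_\infty\in\mathcal{S}_r^+$ such that $\Lambda(P_\infty)=0$ and $B:=A-P_\infty S$ is Hurwitz (all eigenvalues have negative real part). One has $E_{s,s+t}(P_\infty)=E_t(P_\infty)=e^{tB}$. Gramians: $\mathbb{S}_t:=\int_0^t e^{uB'}Se^{uB}\,du$ for $t\ge0$,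 $\mathbb{S}_\infty:=\lim_{t\to\infty}\mathbb{S}_t$; $\mathbb{S}_t$ ($t>0$) and $\mathbb{S}_\infty$ are positive definite. Set $P_\infty^-:=P_\infty-\mathbb{S}_\infty^{-1}$, which is negative definite.
   Formalization: In the first uniform estimate the constant c is allowed to depend on δ as well as on (A,R,S); a constant independent of δ is impossible in general (e.g. r=2, A=[[0,1],[0,0]], S=diag(1,0), R=I, with s=t→0). *)

(* Defs.v *)
From HB Require Import structures.
From mathcomp Require Import all_boot all_order all_algebra.
From mathcomp Require Import all_classical all_reals all_analysis.
From mathcomp Require Import complex.

Set Implicit Arguments.
Unset Strict Implicit.
Unset Printing Implicit Defensive.

Import Order.TTheory GRing.Theory Num.Theory.
Import numFieldNormedType.Exports.

Local Open Scope classical_set_scope.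
Local Open Scope ring_scope.

Section Matrices.
Variables (K : realType) (r : nat).
Implicit Types (M A B C R S P Q : 'M[K]_r) (x : 'cV[K]_r).

Definition psdmx M : Prop :=
  M^T = M /\ forall x, 0 <= (x^T *m M *m x) 0 0.

Definition pdmx M : Prop :=
  M^T = M /\ forall x, x != 0 -> 0 < (x^T *m M *m x) 0 0.

Definition eucl_norm x : K := Num.sqrt (\sum_i x i 0 ^+ 2).

(* The library norm on 'M_r is the max norm; this is the spectral norm, as the
   operator norm induced by the Euclidean norm. *)
Definition spectral_norm M : K :=
  sup [set eucl_norm (M *m x) | x in [set x | eucl_norm x <= 1]].

(* Meaningful for a symmetric M and r > 0: the set of eigenvalues is then
   finite and nonempty. *)
Definition lambda_min M : K := inf [set a | eigenvalue M a].

Definition hurwitz M : Prop :=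
  forall z : K[i],
    eigenvalue (map_mx (real_complex K) M) z -> complex.Re z < 0.

Definition observable A C : Prop := \rank (\mxcol_(i < r) (C *m A ^+ i)) = r.

Definition controllable A C : Prop := \rank (\mxrow_(i < r) (A ^+ i *m C)) = r.

Definition expmx M : 'M[K]_r :=
  lim (series (fun k => k`!%:R^-1 *: M ^+ k) @ \oo).

Definition gramian B S (t : K) : 'M[K]_r :=
  \matrix_(i, j) \int[lebesgue_measure]_(u in `[0, t])
    (expmx (u *: B^T) *m S *m expmx (u *: B)) i j.

Definition gramian_infty B S : 'M[K]_r := lim (gramian B S t @[t --> +oo]).

(* l is the derivative at t of f restricted to [a, +oo[: the two-sided
   derivative for t > a, the right derivative for t = a. *)
Definition has_derivative_from (a : K) (f : K -> 'M[K]_r) (t : K) (l : 'M[K]_r)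
    : Prop :=
  h^-1 *: (f (t + h) - f t) @[h --> within [set h | a <= t + h] 0^'] --> l.

Definition riccati A R S P : 'M[K]_r := A *m P + P *m A^T + R - P *m S *m P.

(* phi t Q is phi_t(Q); nothing is required for t < 0 or for Q not positive
   semi-definite. *)
Definition is_riccati_flow A R S (phi : K -> 'M[K]_r -> 'M[K]_r) : Prop :=
  forall Q, psdmx Q ->
    phi 0 Q = Q /\
    forall t, 0 <= t ->
      psdmx (phi t Q) /\
      has_derivative_from 0 (phi^~ Q) t (riccati A R S (phi t Q)).

(* E s t Q is E_{s,t}(Q). *)
Definition is_exp_semigroup A S (phi : K -> 'M[K]_r -> 'M[K]_r)
    (E : K -> K -> 'M[K]_r -> 'M[K]_r) : Prop :=
  forall Q, psdmx Q -> forall s, 0 <= s ->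
    E s s Q = 1%:M /\
    forall t, s <= t ->
      has_derivative_from s ((E s)^~ Q) t ((A - phi t Q *m S) *m E s t Q).

Definition is_riccati_fixpoint A R S P : Prop :=
  [/\ pdmx P, riccati A R S P = 0 & hurwitz (A - P *m S)].

Definition Pinfty_minus A S P : 'M[K]_r :=
  P - invmx (gramian_infty (A - P *m S) S).

Definition chi A S P (delta : K) : K :=
  (lambda_min (gramian (A - P *m S) S delta)
   * lambda_min (- Pinfty_minus A S P))^-1.

End Matrices.

(* Main.v *)
(* Write B = A - P S with P the stabilizing fixed point, e(t) = e^(tB), S_t for the
   Gramian, G for its limit, and D_t = phi_(s+t)(Q) - P, so that
   D' = B D + D B' - D S D. The matrix Z(t) = (1 + D_0 S_t) e(-t) satisfies
   Z D_t = D_0 e(t)' by uniqueness for a linear equation, hence Z E_(s,s+t)(Q) is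
   constant, equal to 1, and E_(s,s+t)(Q) = e(t) (1 + D_0 S_t)^-1.
   With W = (S_t^-1 + D_0)^-1 one has (1 + D_0 S_t)^-1 = 1 - D_0 W = S_t^-1 W.
   Since S_t <= G and phi_s(Q) >= 0, S_t^-1 + D_0 >= G^-1 - P = - P^-, which is
   positive definite, so W is bounded uniformly in Q and t: the second form of the
   inverse gives the bound by chi, the first one a bound linear in phi_s(Q). Finally
   phi_s(Q) - P = e(s) (D_0 - D_0 W D_0) e(s)' = e(s) (S_s^-1 - S_s^-1 W S_s^-1) e(s)'
   is at most e(s) Q e(s)' and at most e(s) S_s^-1 e(s)'. *)

From HB Require Import structures.
Require Import Defs.
From mathcomp Require Import all_boot all_order all_algebra.
From mathcomp Require Import all_classical all_reals all_analysis.
From mathcomp Require Import complex ring lra.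

Set Implicit Arguments.
Unset Strict Implicit.
Unset Printing Implicit Defensive.

Import Order.TTheory GRing.Theory Num.Theory.
Import numFieldNormedType.Exports.

Local Open Scope classical_set_scope.
Local Open Scope ring_scope.

(** * Euclidean and spectral norms, quadratic forms *)

(** [1 + D_0 S_t] is not symmetric and [D_0] ranges over an unbounded set, so its inverse has no
    evident bound. Factoring out [S_t] leaves the symmetric matrix [S_t^-1 + D_0], which the Loewner
    order bounds below by a constant depending neither on [Q] nor on [t]; the price is that [t = 0],
    where [S_t = 0], is treated apart. Observability makes the Gramians invertible, controllability
    makes [- P^-] positive definite. [G] is obtained as the solution of [B'G + G B = - S], which
    gives the closed form [S_t = G - e(t)' G e(t)]. With [l = lambda_min(- P^-)], the first form of
    the inverse is bounded by [1 + (|phi_s(Q)| + |P|) / l]. Into it go [|phi_s(Q)| <= |P| + c^2 |Q|]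
    in general, and [|phi_s(Q)| <= |P| + c^2 / lambda_min(S_delta)] for [s >= delta], where [c]
    bounds every [e(t)], [t >= 0]. The constants are fixed before the fixed point is given, which is
    why its uniqueness is proved. *)

Section EuclideanNorm.
Variable K : realType.

Definition vdot n (x y : 'cV[K]_n) : K := (x^T *m y) 0 0.

Section Vdot.
Variable n : nat.
Implicit Types (x y z : 'cV[K]_n) (M N : 'M[K]_n).

Lemma vdotE x y : vdot x y = \sum_i x i 0 * y i 0.
Proof. by rewrite /vdot mxE; apply: eq_bigr => i _; rewrite mxE. Qed.

Lemma vdotC x y : vdot x y = vdot y x.
Proof. by rewrite !vdotE; apply: eq_bigr => i _; rewrite mulrC. Qed.

Lemma vdotDr x y z : vdot x (y + z) = vdot x y + vdot x z.
Proof. by rewrite /vdot mulmxDr mxE. Qed.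

Lemma vdotZr a x y : vdot x (a *: y) = a * vdot x y.
Proof. by rewrite /vdot -scalemxAr mxE. Qed.

Lemma vdotDl x y z : vdot (x + y) z = vdot x z + vdot y z.
Proof. by rewrite vdotC vdotDr !(vdotC z). Qed.

Lemma vdotZl a x y : vdot (a *: x) y = a * vdot x y.
Proof. by rewrite vdotC vdotZr vdotC. Qed.

Lemma vdotNr x y : vdot x (- y) = - vdot x y.
Proof. by rewrite -scaleN1r vdotZr mulN1r. Qed.

Lemma vdotBr x y z : vdot x (y - z) = vdot x y - vdot x z.
Proof. by rewrite vdotDr vdotNr. Qed.

Lemma vdotBl x y z : vdot (x - y) z = vdot x z - vdot y z.
Proof. by rewrite vdotC vdotBr !(vdotC z). Qed.

Lemma vdot_mulmx M x y : vdot x (M *m y) = vdot (M^T *m x) y.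
Proof. by rewrite /vdot trmx_mul trmxK mulmxA. Qed.

Lemma quadE M x : (x^T *m M *m x) 0 0 = vdot x (M *m x).
Proof. by rewrite /vdot mulmxA. Qed.

Lemma vdot_ge0 x : 0 <= vdot x x.
Proof. by rewrite vdotE sumr_ge0 // => i _; rewrite -expr2 sqr_ge0. Qed.

Lemma vdot_eq0 x : (vdot x x == 0) = (x == 0).
Proof.
apply/eqP/eqP => [|->]; last by rewrite /vdot mulmx0 mxE.
rewrite vdotE => /eqP; rewrite psumr_eq0; last first.
  by move=> i _; rewrite -expr2 sqr_ge0.
move=> /allP x0; apply/colP => i; rewrite mxE.
by have := x0 i (mem_index_enum _); rewrite /= mulf_eq0 orbb => /eqP.
Qed.

Lemma vdot_gt0 x : (0 < vdot x x) = (x != 0).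
Proof. by rewrite lt_neqAle vdot_ge0 andbT eq_sym vdot_eq0. Qed.

Lemma vdot0r x : vdot x 0 = 0.
Proof. by rewrite /vdot mulmx0 mxE. Qed.

Lemma eucl_normE x : eucl_norm x = Num.sqrt (vdot x x).
Proof.
by rewrite /eucl_norm vdotE; congr Num.sqrt; apply: eq_bigr => i _; rewrite expr2.
Qed.

Lemma eucl_norm_ge0 x : 0 <= eucl_norm x.
Proof. exact: sqrtr_ge0. Qed.

Lemma sqr_eucl_norm x : eucl_norm x ^+ 2 = vdot x x.
Proof. by rewrite eucl_normE sqr_sqrtr ?vdot_ge0. Qed.

Lemma eucl_norm0 : eucl_norm (0 : 'cV[K]_n) = 0.
Proof. by rewrite eucl_normE vdot0r sqrtr0. Qed.

Lemma eucl_norm_gt0 x : (0 < eucl_norm x) = (x != 0).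
Proof. by rewrite eucl_normE sqrtr_gt0 vdot_gt0. Qed.

Lemma eucl_normZ a x : eucl_norm (a *: x) = `|a| * eucl_norm x.
Proof.
by rewrite !eucl_normE vdotZl vdotZr mulrA -expr2 sqrtrM ?sqr_ge0 // sqrtr_sqr.
Qed.

Lemma eucl_normN x : eucl_norm (- x) = eucl_norm x.
Proof. by rewrite -scaleN1r eucl_normZ normrN1 mul1r. Qed.

Lemma eucl_norm_le x c : 0 <= c -> (eucl_norm x <= c) = (vdot x x <= c ^+ 2).
Proof.
by move=> c0; rewrite -sqr_eucl_norm ler_pXn2r // nnegrE // eucl_norm_ge0.
Qed.

(* Cauchy-Schwarz for the possibly degenerate form attached to [M]. *)
Lemma psd_cauchy_schwarz M x y : psdmx M ->
  vdot x (M *m y) ^+ 2 <= vdot x (M *m x) * vdot y (M *m y).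
Proof.
move=> [Ms Mp].
have p z : 0 <= vdot z (M *m z) by rewrite -quadE.
have sy : vdot y (M *m x) = vdot x (M *m y) by rewrite vdot_mulmx Ms vdotC.
have q a b : 0 <= a ^+ 2 * vdot x (M *m x) + a * b * vdot x (M *m y) *+ 2
    + b ^+ 2 * vdot y (M *m y).
  have := p (a *: x + b *: y).
  rewrite mulmxDr -!scalemxAr !vdotDl !vdotDr !vdotZl !vdotZr sy.
  by move/le_trans; apply; rewrite le_eqVlt; apply/orP; left; apply/eqP; ring.
have := p x; have := p y; move: q sy => /[swap] _.
set u := vdot x (M *m x); set v := vdot y (M *m y); set w := vdot x (M *m y).
move=> q v0 u0.
have [v1|v1] := eqVneq v 0.
  have [->|w0] := eqVneq w 0; first by rewrite expr0n /= mulr_ge0.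
  (* When [v = 0] the form is affine in [b]; this choice makes it [- u - 2], a contradiction. *)
  have := q 1 (- (u + 1) / w); rewrite v1 mulr0 addr0 expr1n !mul1r divfK //.
  by rewrite mulr2n; nra.
have := q v (- w).
have vp : 0 < v by rewrite lt_neqAle eq_sym v1.
have -> : v ^+ 2 * u + v * - w * w *+ 2 + (- w) ^+ 2 * v = v * (u * v - w ^+ 2).
  by ring.
by rewrite pmulr_rge0 // subr_ge0.
Qed.

Lemma psdmx1 : psdmx (1%:M : 'M[K]_n).
Proof. by split=> [|x]; rewrite ?trmx1 // quadE mul1mx vdot_ge0. Qed.

Lemma cauchy_schwarz x y : `|vdot x y| <= eucl_norm x * eucl_norm y.
Proof.
have := psd_cauchy_schwarz x y psdmx1; rewrite !mul1mx -!sqr_eucl_norm -exprMn.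
rewrite -(real_normK (num_real (vdot x y))) ler_pXn2r ?nnegrE //.
by rewrite mulr_ge0 // eucl_norm_ge0.
Qed.

Lemma eucl_norm_triangle x y : eucl_norm (x + y) <= eucl_norm x + eucl_norm y.
Proof.
rewrite eucl_norm_le ?addr_ge0 ?eucl_norm_ge0 //.
rewrite vdotDl !vdotDr (vdotC y x) -!sqr_eucl_norm sqrrD.
by have := le_trans (ler_norm _) (cauchy_schwarz x y); lra.
Qed.

End Vdot.

(** * Operator bounds, coercivity and the smallest eigenvalue *)

Section OperatorBounds.
Variable n : nat.
Implicit Types (x y z : 'cV[K]_n) (M N : 'M[K]_n).

(** Arbitrary bounds compose without touching a supremum; [opbound_spectral_norm] and
    [spectral_norm_le] translate to and from the norm. *)
Definition opbound M c := forall x, eucl_norm (M *m x) <= c * eucl_norm x.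

(** Cauchy-Schwarz on each row. It shows that the supremum in [spectral_norm] is finite, and turns
    entrywise bounds into operator bounds. *)
Lemma opbound_frobenius M : opbound M (Num.sqrt (\sum_i \sum_j M i j ^+ 2)).
Proof.
set c2 := \sum_i \sum_j M i j ^+ 2.
have c20 : 0 <= c2 by apply: sumr_ge0 => i _; apply: sumr_ge0 => j _; exact: sqr_ge0.
move=> x; rewrite eucl_norm_le ?mulr_ge0 ?sqrtr_ge0 ?eucl_norm_ge0 //.
rewrite exprMn sqr_sqrtr // sqr_eucl_norm [leLHS]vdotE /c2 mulr_suml.
apply: ler_sum => i _; rewrite -expr2.
have -> : (M *m x) i 0 = vdot (row i M)^T x by rewrite /vdot trmxK -row_mul [RHS]mxE.
have -> : \sum_j M i j ^+ 2 = vdot (row i M)^T (row i M)^T.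
  by rewrite vdotE; apply: eq_bigr => j _; rewrite !mxE expr2.
rewrite -(real_normK (num_real (vdot _ _))) -(sqr_eucl_norm (row i M)^T) -sqr_eucl_norm -exprMn.
by rewrite ler_pXn2r ?nnegrE ?mulr_ge0 ?eucl_norm_ge0 // cauchy_schwarz.
Qed.

Lemma ex_opbound M : exists2 c, 0 <= c & opbound M c.
Proof. by eexists; last exact: opbound_frobenius; exact: sqrtr_ge0. Qed.

Lemma spectral_norm_has_sup M :
  has_sup [set eucl_norm (M *m x) | x in [set x | eucl_norm x <= 1]].
Proof.
split; first by exists (eucl_norm (M *m 0)), 0 => //=; rewrite eucl_norm0.
have [c c0 Mc] := ex_opbound M; exists c => _ [x /= x1 <-].
by apply: (le_trans (Mc x)); rewrite ler_piMr.
Qed.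

Lemma spectral_norm_ge0 M : 0 <= spectral_norm M.
Proof.
rewrite -(@eucl_norm0 n) -(mulmx0 _ M); apply: ub_le_sup.
  exact: (spectral_norm_has_sup M).2.
by exists 0 => //=; rewrite eucl_norm0.
Qed.

Lemma opbound_spectral_norm M : opbound M (spectral_norm M).
Proof.
move=> x; have [->|x0] := eqVneq x 0; first by rewrite mulmx0 eucl_norm0 mulr0.
have xp : 0 < eucl_norm x by rewrite eucl_norm_gt0.
have := @ub_le_sup _ _ (spectral_norm_has_sup M).2
  (eucl_norm (M *m ((eucl_norm x)^-1 *: x))).
rewrite -scalemxAr eucl_normZ ger0_norm ?invr_ge0 ?eucl_norm_ge0 //.
rewrite -ler_pdivrMr // mulrC; apply.
exists ((eucl_norm x)^-1 *: x); last first.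
  by rewrite -scalemxAr eucl_normZ ger0_norm ?invr_ge0 ?eucl_norm_ge0 // mulrC.
by rewrite /= eucl_normZ ger0_norm ?mulVf ?gt_eqF // invr_ge0 eucl_norm_ge0.
Qed.

Lemma spectral_norm_le M c : 0 <= c -> opbound M c -> spectral_norm M <= c.
Proof.
move=> c0 Mc; apply: ge_sup; first exact: (spectral_norm_has_sup M).1.
by move=> _ [x /= x1 <-]; apply: (le_trans (Mc x)); rewrite ler_piMr.
Qed.

Lemma opboundD M N a b : opbound M a -> opbound N b -> opbound (M + N) (a + b).
Proof.
move=> Ma Nb x; rewrite mulmxDl mulrDl.
by apply: (le_trans (eucl_norm_triangle _ _)); apply: lerD.
Qed.

Lemma opboundN M a : opbound M a -> opbound (- M) a.
Proof. by move=> Ma x; rewrite mulNmx eucl_normN. Qed.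

Lemma opboundM M N a b : 0 <= a -> opbound M a -> opbound N b ->
  opbound (M *m N) (a * b).
Proof.
move=> a0 Ma Nb x; rewrite -mulmxA -mulrA.
by apply: (le_trans (Ma _)); apply: ler_wpM2l.
Qed.

Lemma opbound_le M a b : a <= b -> opbound M a -> opbound M b.
Proof.
by move=> ab Ma x; apply: (le_trans (Ma x)); rewrite ler_wpM2r ?eucl_norm_ge0.
Qed.

Lemma opbound1 : opbound 1%:M 1.
Proof. by move=> x; rewrite mul1mx mul1r. Qed.

Lemma spectral_normM M N : spectral_norm (M *m N) <= spectral_norm M * spectral_norm N.
Proof.
apply: spectral_norm_le; first by rewrite mulr_ge0 ?spectral_norm_ge0.
by apply: opboundM; rewrite ?spectral_norm_ge0 //; exact: opbound_spectral_norm.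
Qed.

(** [|M'x|^2 = <x, M M'x> <= |x| c |M'x|], and one factor [|M'x|] cancels. *)
Lemma opbound_tr M c : 0 <= c -> opbound M c -> opbound M^T c.
Proof.
move=> c0 Mc x; have [->|y0] := eqVneq (M^T *m x) 0.
  by rewrite eucl_norm0 mulr_ge0 ?eucl_norm_ge0.
have yp : 0 < eucl_norm (M^T *m x) by rewrite eucl_norm_gt0.
rewrite -(ler_pM2l yp) -expr2 sqr_eucl_norm -vdot_mulmx vdotC.
apply: (le_trans (le_trans (ler_norm _) (cauchy_schwarz _ _))).
by rewrite mulrCA mulrA ler_wpM2r ?eucl_norm_ge0 // Mc.
Qed.

Lemma vdot_opbound M c x : opbound M c -> vdot x (M *m x) <= c * vdot x x.
Proof.
move=> Mc; apply: (le_trans (le_trans (ler_norm _) (cauchy_schwarz _ _))).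
by rewrite -sqr_eucl_norm expr2 mulrCA ler_wpM2l ?eucl_norm_ge0.
Qed.

Lemma psd_vdot_ge0 M x : psdmx M -> 0 <= vdot x (M *m x).
Proof. by move=> [_ /(_ x)]; rewrite quadE. Qed.

(** This is [M^2 <= c M] without diagonalization: Cauchy-Schwarz for the form of [M] at [M x] and
    [x], then division by [|M x|^2]. It converts bounds on quadratic forms into operator bounds. *)
Lemma psd_sqr_mulmx M c x : psdmx M -> (forall y, vdot y (M *m y) <= c * vdot y y) ->
  vdot (M *m x) (M *m x) <= c * vdot x (M *m x).
Proof.
move=> Mp Mc; have [->|y0] := eqVneq (M *m x) 0.
  rewrite !vdot0r mulr0 //.
have := psd_cauchy_schwarz (M *m x) x Mp.
move/le_trans/(_ (ler_wpM2r (psd_vdot_ge0 x Mp) (Mc (M *m x)))).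
by rewrite mulrAC expr2 ler_pM2r // vdot_gt0.
Qed.

Lemma psd_opbound M c : 0 <= c -> psdmx M ->
  (forall y, vdot y (M *m y) <= c * vdot y y) -> opbound M c.
Proof.
move=> c0 Mp Mc x; rewrite eucl_norm_le ?mulr_ge0 ?eucl_norm_ge0 //.
apply: (le_trans (psd_sqr_mulmx x Mp Mc)).
by rewrite exprMn sqr_eucl_norm expr2 -mulrA ler_wpM2l.
Qed.

Lemma psd_ker M x : psdmx M -> vdot x (M *m x) = 0 -> M *m x = 0.
Proof.
move=> Mp Mx; have [c c0 Mc] := ex_opbound M.
apply/eqP; rewrite -vdot_eq0 eq_le vdot_ge0 andbT.
by rewrite (le_trans (psd_sqr_mulmx x Mp (fun y => vdot_opbound y Mc))) // Mx mulr0.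
Qed.

Definition coercive M l := forall x, l * vdot x x <= vdot x (M *m x).

Lemma coercive_eucl_norm M l x : coercive M l -> l * eucl_norm x <= eucl_norm (M *m x).
Proof.
move=> Ml; have [->|x0] := eqVneq x 0; first by rewrite mulmx0 eucl_norm0 mulr0.
have xp : 0 < eucl_norm x by rewrite eucl_norm_gt0.
rewrite -(ler_pM2l xp) mulrCA -expr2 sqr_eucl_norm (le_trans (Ml x)) //.
by rewrite (le_trans (le_trans (ler_norm _) (cauchy_schwarz _ _))).
Qed.

Lemma mulmx_unit M : (forall x, M *m x = 0 -> x = 0) -> M \in unitmx.
Proof.
move=> Mi; rewrite -unitmx_tr -row_free_unit -kermx_eq0.
apply/eqP/trmx_inj; rewrite trmx0; apply/matrixP => i j.
have /matrixP/(_ i 0) : (row j (kermx M^T))^T = 0.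
  by apply: Mi; rewrite -{1}[M]trmxK -trmx_mul -row_mul mulmx_ker row0 trmx0.
by rewrite !mxE.
Qed.

Lemma coercive_unit M l : 0 < l -> coercive M l -> M \in unitmx.
Proof.
move=> l0 Ml; apply: mulmx_unit => x Mx; apply/eqP; rewrite -vdot_eq0.
rewrite eq_le vdot_ge0 andbT -(ler_pM2l l0) mulr0.
by apply: (le_trans (Ml x)); rewrite Mx vdot0r.
Qed.

Lemma coercive_inv M l : 0 < l -> coercive M l -> opbound (invmx M) l^-1.
Proof.
move=> l0 Ml x; rewrite ler_pdivlMl //.
have := coercive_eucl_norm (invmx M *m x) Ml.
by rewrite mulmxA mulmxV ?mul1mx // (coercive_unit l0 Ml).
Qed.

(** If [a] bounds [M] and [b] bounds its inverse, then [|x|^2 <= b^2 |M x|^2 <= b^2 a <x, M x>].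
    Adding 1 to [a] and [b] keeps the constant invertible. *)
Lemma psd_unit_coercive M : psdmx M -> M \in unitmx ->
  exists2 l, 0 < l & coercive M l.
Proof.
move=> Mp Mu; have [a a0 Ma] := ex_opbound M; have [b b0 Mb] := ex_opbound (invmx M).
exists ((b + 1) ^+ 2 * (a + 1))^-1; first by rewrite invr_gt0 mulr_gt0 ?exprn_gt0; lra.
move=> x; rewrite ler_pdivrMl; last by rewrite mulr_gt0 ?exprn_gt0; lra.
have h1 := psd_sqr_mulmx x Mp (fun y => vdot_opbound y Ma).
have := Mb (M *m x); rewrite mulmxA mulVmx // mul1mx.
rewrite eucl_norm_le ?mulr_ge0 ?eucl_norm_ge0 // exprMn sqr_eucl_norm.
move/le_trans; apply; apply: (le_trans (ler_wpM2l (sqr_ge0 _) h1)).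
rewrite mulrA ler_wpM2r ?psd_vdot_ge0 //; nra.
Qed.

Lemma pd_psd M : pdmx M -> psdmx M.
Proof.
move=> [Ms Mp]; split=> // x; have [->|x0] := eqVneq x 0.
  by rewrite quadE mulmx0 vdot0r.
exact/ltW/Mp.
Qed.

Lemma pd_unit M : pdmx M -> M \in unitmx.
Proof.
move=> Mp; apply: mulmx_unit => x Mx; apply/eqP; apply/negPn/negP => x0.
by have := Mp.2 x x0; rewrite quadE Mx vdot0r ltxx.
Qed.

Lemma coercive_pd M l : M^T = M -> 0 < l -> coercive M l -> pdmx M.
Proof.
move=> Ms l0 Ml; split=> // x x0; rewrite quadE; apply: (lt_le_trans _ (Ml x)).
by rewrite mulr_gt0 // vdot_gt0.
Qed.

(* The infimum [m] of the Rayleigh quotient is an eigenvalue: otherwise [M - m]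
   is psd and invertible, hence coercive, and [m] could be increased. *)
Lemma rayleigh_eigenvalue M : (0 < n)%N -> M^T = M ->
  exists2 m, coercive M m & eigenvalue M m.
Proof.
move=> n0 Ms; pose A := [set vdot x (M *m x) | x in [set x : 'cV[K]_n | vdot x x = 1]].
have [c c0 Mc] := ex_opbound M.
have A0 : A !=set0.
  pose e : 'cV[K]_n := delta_mx (Ordinal n0) 0.
  exists (vdot e (M *m e)), e => //=.
  rewrite vdotE (bigD1 (Ordinal n0)) //= big1 ?addr0 => [|i /negPf ni].
    by rewrite !mxE !eqxx mulr1.
  by rewrite !mxE ni mul0r.
have Al : has_lbound A.
  exists (- c) => _ [x /= x1 <-]; have := vdot_opbound x (opboundN Mc).
  by rewrite x1 mulNmx vdotNr mulr1; lra.
pose m := inf A.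
have coe l : (forall a, A a -> l <= a) -> coercive M l.
  move=> lA x; have [->|x0] := eqVneq x 0; first by rewrite mulmx0 !vdot0r mulr0.
  have xp : 0 < eucl_norm x by rewrite eucl_norm_gt0.
  have /lA : A (vdot ((eucl_norm x)^-1 *: x) (M *m ((eucl_norm x)^-1 *: x))).
    exists ((eucl_norm x)^-1 *: x) => //=.
    by rewrite vdotZl vdotZr -sqr_eucl_norm expr2; field; rewrite gt_eqF.
  rewrite -scalemxAr vdotZl vdotZr mulrA -invfM -expr2 sqr_eucl_norm.
  by rewrite -ler_pdivrMl ?invr_gt0 ?vdot_gt0 // invrK mulrC.
have Mm : coercive M m by apply: coe => y Ay; exact: ge_inf.
exists m => //.
have Np : psdmx (M - m%:M).
  split=> [|x]; first by rewrite linearB /= tr_scalar_mx Ms.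
  by rewrite quadE mulmxBl mul_scalar_mx vdotBr vdotZr subr_ge0 Mm.
rewrite /eigenvalue /eigenspace kermx_eq0 row_free_unit; apply/negP => Nu.
have [l l0 Nl] := psd_unit_coercive Np Nu.
have : m + l <= m.
  apply: lb_le_inf => // _ [x /= x1 <-]; have := Nl x.
  by rewrite mulmxBl mul_scalar_mx vdotBr vdotZr x1; lra.
by lra.
Qed.

Lemma eigenvalue_coercive M l a : coercive M l -> eigenvalue M a -> l <= a.
Proof.
move=> Ml /eigenvalueP [v vM v0].
have : v^T != 0 by rewrite -trmx0 (inj_eq trmx_inj).
rewrite -vdot_gt0 => vp; rewrite -(ler_pM2r vp) (le_trans (Ml v^T)) //.
by rewrite vdot_mulmx -trmx_mul vM linearZ /= vdotZl.
Qed.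

Lemma lambda_min_coercive M : (0 < n)%N -> M^T = M -> coercive M (lambda_min M).
Proof.
move=> n0 Ms; have [m Mm em] := rayleigh_eigenvalue n0 Ms => x.
apply: le_trans (Mm x); rewrite ler_wpM2r ?vdot_ge0 //.
by apply: ge_inf => //; exists m => a /=; exact: eigenvalue_coercive.
Qed.

Lemma lambda_min_gt0 M : (0 < n)%N -> pdmx M -> 0 < lambda_min M.
Proof.
move=> n0 Mp; have [l l0 Ml] := psd_unit_coercive (pd_psd Mp) (pd_unit Mp).
apply: (lt_le_trans l0); have [m _ em] := rayleigh_eigenvalue n0 Mp.1.
by apply: lb_le_inf => [|a /= ea]; [exists m | exact: eigenvalue_coercive ea].
Qed.

Lemma invmx_sym M : M^T = M -> (invmx M)^T = invmx M.
Proof. by move=> Ms; rewrite trmx_inv Ms. Qed.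

Lemma pd_inv M : pdmx M -> pdmx (invmx M).
Proof.
move=> Mp; have Mu := pd_unit Mp; split=> [|x x0]; first exact/invmx_sym/Mp.1.
rewrite quadE; have {1}-> : x = M *m (invmx M *m x) by rewrite mulmxA mulmxV ?mul1mx.
rewrite vdotC -quadE; apply: Mp.2; apply/eqP => y0.
by move/eqP: x0; apply; rewrite -[x]mul1mx -(mulmxV Mu) -mulmxA y0 mulmx0.
Qed.

(* [x' M^-1 x] is the maximum over [y] of [2 x'y - y'My]. *)
Lemma pd_inv_le M N : pdmx M -> pdmx N ->
  (forall x, vdot x (M *m x) <= vdot x (N *m x)) ->
  forall x, vdot x (invmx N *m x) <= vdot x (invmx M *m x).
Proof.
move=> Mp Np MN x; pose y := invmx N *m x.
have Mu := pd_unit Mp; have Nu := pd_unit Np.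
(* The square behind this maximum, taken at [y = N^-1 x], where the maximum for [N] is attained. *)
have := psd_vdot_ge0 (x - M *m y) (pd_psd (pd_inv Mp)).
rewrite mulmxBr (mulmxA _ M) mulVmx // mul1mx vdotBl !vdotBr.
have -> : vdot (M *m y) (invmx M *m x) = vdot x y.
  rewrite -{1}Mp.1 -vdot_mulmx mulmxA mulmxV // mul1mx; exact: vdotC.
rewrite (vdotC (M *m y) y) -/y; have := MN y.
have -> : N *m y = x by rewrite mulmxA mulmxV ?mul1mx.
by rewrite (vdotC y x); lra.
Qed.

End OperatorBounds.
End EuclideanNorm.

(** * Differentiable trajectories on the half-line *)

Section Trajectories.
Variable K : realType.

Section Scalar.
Implicit Types f g : K -> K.

(** The flow lives on nonnegative times only. Continuity up to 0 and a derivative at positive times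
    are what the mean value theorem on [[a, b]], [0 <= a], asks for. *)
Definition straj (f f' : K -> K) := {within `[0, +oo[, continuous f} /\
  forall t : K, 0 < t -> is_derive t (1 : K) f (f' t).

Lemma straj_eq f f' g' : (forall t : K, 0 < t -> f' t = g' t) -> straj f f' -> straj f g'.
Proof.
move=> fg [cf df]; split=> // t t0; apply: is_derive_eq (fg t t0); exact: df.
Qed.

Lemma straj_derivable f f' : (forall t, is_derive t (1 : K) f (f' t)) -> straj f f'.
Proof.
move=> df; split=> [|t _]; last exact: df.
apply: continuous_subspaceT => t.
apply/differentiable_continuous/derivable1_diffP; exact: (@ex_derive _ _ _ _ _ _ _ (df t)).
Qed.

Lemma straj_cst c : straj (fun=> c) (fun=> 0).
Proof. by apply: straj_derivable => t; exact: is_derive_cst. Qed.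

Lemma strajD f g f' g' : straj f f' -> straj g g' ->
  straj (fun t => f t + g t) (fun t => f' t + g' t).
Proof.
move=> [cf df] [cg dg]; split; first exact: within_continuousD cf cg.
move=> t t0; apply: is_deriveD; [exact: df | exact: dg].
Qed.

Lemma strajM f g f' g' : straj f f' -> straj g g' ->
  straj (fun t => f t * g t) (fun t => f t * g' t + g t * f' t).
Proof.
move=> [cf df] [cg dg]; split.
  by move=> t; apply: cvgM; [exact: cf | exact: cg].
move=> t t0; apply: is_deriveM; [exact: df | exact: dg].
Qed.

Lemma straj_sum (I : Type) (s : seq I) (f f' : I -> K -> K) :
  (forall i, straj (f i) (f' i)) ->
  straj (fun t => \sum_(i <- s) f i t) (fun t => \sum_(i <- s) f' i t).
Proof.
move=> ff'; elim: s => [|i s IH].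
  have -> : (fun t => \sum_(i <- [::]) f i t) = fun=> 0.
    by apply/funext => t; rewrite big_nil.
  by apply: straj_eq (straj_cst 0) => t _; rewrite big_nil.
have -> : (fun t => \sum_(j <- i :: s) f j t) = fun t => f i t + \sum_(j <- s) f j t.
  by apply/funext => t; rewrite big_cons.
by apply: straj_eq (strajD (ff' i) IH) => t _; rewrite big_cons.
Qed.

Lemma straj_MVT f f' a b : straj f f' -> 0 <= a -> a < b ->
  exists2 c, a < c < b & f b - f a = f' c * (b - a).
Proof.
move=> [cf df] a0 ab; have [||c] := @MVT K f f' a b ab.
- by move=> t; rewrite in_itv /= => /andP[at_ _]; exact/df/(le_lt_trans a0 at_).
- apply: continuous_subspaceW cf => t /=; rewrite !in_itv /= andbT => /andP[+ _].
  exact: le_trans.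
by rewrite in_itv /= => cab ->; exists c.
Qed.

Lemma straj_nonincreasing f f' a b : straj f f' -> 0 <= a -> a <= b ->
  (forall t : K, a < t < b -> f' t <= 0) -> f b <= f a.
Proof.
move=> ff' a0; rewrite le_eqVlt => /predU1P[-> //|ab] f'0.
have [c cab e] := straj_MVT ff' a0 ab.
by rewrite -subr_le0 e mulr_le0_ge0 ?f'0 // subr_ge0 ltW.
Qed.

Lemma straj_nondecreasing f f' a b : straj f f' -> 0 <= a -> a <= b ->
  (forall t : K, a < t < b -> 0 <= f' t) -> f a <= f b.
Proof.
move=> ff' a0; rewrite le_eqVlt => /predU1P[-> //|ab] f'0.
have [c cab e] := straj_MVT ff' a0 ab.
by rewrite -subr_ge0 e mulr_ge0 ?f'0 // subr_ge0 ltW.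
Qed.

Lemma straj_bounded f f' T : straj f f' -> 0 <= T ->
  exists c, forall t : K, 0 <= t <= T -> `|f t| <= c.
Proof.
move=> [cf _] T0.
have cg : {within `[0, T], continuous f}.
  by apply: continuous_subspaceW cf => t /=; rewrite !in_itv /= andbT => /andP[].
have [a _ fa] := EVT_max T0 cg; have [b _ fb] := EVT_min T0 cg.
exists (Num.max `|f a| `|f b|) => t tT.
have {}tT : t \in `[0, T] by rewrite in_itv.
rewrite le_max !ler_norml; have := fa _ tT; have := fb _ tT.
have := ler_norm (f a); have := ler_norm (- f b); rewrite normrN.
by move=> h1 h2 h3 h4; case: (lerP 0 (f t)) => ft; apply/orP; [left|right]; lra.
Qed.

Lemma straj_expR a : straj (fun t => expR (a * t)) (fun t => a * expR (a * t)).
Proof.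
apply: straj_derivable => t.
have : is_derive t (1 : K) ( *%R a) a.
  apply: (is_derive_eq (is_deriveZ a (is_derive_id _ _))).
  by rewrite /GRing.scale /= mulr1.
move=> d; have := @is_derive1_comp K (@expR K) ( *%R a) t _ _ (is_derive_expR _) d.
by rewrite mulrC.
Qed.

(* The derivative of [e^(-ct) f(t)] has the sign of [f' - cf]. *)
Lemma straj_exp_bound f f' c a b : straj f f' -> 0 <= a -> a <= b ->
  (forall t : K, a < t < b -> f' t <= c * f t) -> f b <= expR (c * (b - a)) * f a.
Proof.
move=> ff' a0 ab f'c.
have := straj_nonincreasing (strajM (straj_expR (- c)) ff') a0 ab.
have h t : a < t < b ->
    expR (- c * t) * f' t + f t * (- c * expR (- c * t)) <= 0.
  move=> tab; have := f'c t tab; have := expR_gt0 (- c * t).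
  set E := expR _ => E0 H; have -> : E * f' t + f t * (- c * E) = E * (f' t - c * f t).
    by ring.
  by rewrite pmulr_rle0 // subr_le0.
move/(_ h) => H; rewrite -(ler_pM2l (expR_gt0 (- c * b))) mulrA -expRD.
by have -> : - c * b + c * (b - a) = - c * a by ring.
Qed.

Lemma expR_cvg0 a : 0 < a -> expR (- a * t) @[t --> +oo] --> (0 : K).
Proof.
move=> a0.
have : (expR (- x) : K) @[x --> +oo] --> (0 : K) by exact: cvgr_expR.
move=> /cvgrPdist_lt H; apply/cvgrPdist_lt => e e0.
have [M [Mr HM]] := H e e0; exists (M / a); split; first exact: num_real.
by move=> t tM; have := HM (a * t); rewrite mulNr; apply; rewrite mulrC -ltr_pdivrMr.
Qed.

(** Once [|h| < a e / 2], the function [f - e / 2] satisfies [g' <= - a g], so it is eventually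
    below [e / 2]. *)
Lemma straj_decay f f' h a : straj f f' -> 0 < a -> (forall t, 0 <= f t) ->
  h t @[t --> +oo] --> (0 : K) ->
  (forall t : K, 0 < t -> f' t <= - a * f t + h t) -> f t @[t --> +oo] --> (0 : K).
Proof.
move=> ff' a0 f0 h0 f'h; apply/cvgrPdist_lt => e e0.
have e2 : 0 < e / 2 by rewrite divr_gt0.
have /cvgrPdist_lt/(_ _ (mulr_gt0 a0 e2)) [M [_ hM]] := h0.
pose T := Num.max M 1; have T0 : 0 <= T by rewrite le_max ler01 orbT.
pose g t := f t + - (e / 2).
have gt : straj g (fun t => f' t + 0) := strajD ff' (straj_cst _).
have gle t : T <= t -> g t <= expR (- a * (t - T)) * g T.
  move=> Tt; apply: (straj_exp_bound gt T0 Tt) => s /andP[Ts _].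
  have Ms : M < s by apply: le_lt_trans Ts; rewrite le_max lexx.
  have := f'h s (le_lt_trans T0 Ts); have := hM s Ms; rewrite sub0r normrN.
  by move=> /ltr_normlP [_ H]; rewrite addr0 /g; lra.
have /cvgrPdist_lt/(_ (e / 2 / (`|g T| + 1))) := expR_cvg0 a0.
have gT : 0 < `|g T| + 1 by rewrite ltr_wpDl.
case; first by rewrite divr_gt0.
move=> M2 [_ hM2]; exists (Num.max T (M2 + T)); split; first exact: num_real.
move=> t; rewrite gt_max => /andP[Tt M2t]; rewrite sub0r normrN ger0_norm //.
have := hM2 (t - T); rewrite ltrBrDr => /(_ M2t).
rewrite sub0r normrN ger0_norm ?expR_ge0 // ltr_pdivlMr //.
have := gle t (ltW Tt); have := expR_ge0 (- a * (t - T)).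
set E := expR _ => E0 h1 h2; have := ler_norm (g T); rewrite /g in h1 *; nra.
Qed.

End Scalar.

(** * Matrix-valued trajectories and linear differential equations *)

Section Matrix.

Definition traj m n (f f' : K -> 'M[K]_(m, n)) :=
  forall i j, straj (fun t => f t i j) (fun t => f' t i j).

Lemma traj_eq m n (f f' g' : K -> 'M[K]_(m, n)) :
  (forall t : K, 0 < t -> f' t = g' t) -> traj f f' -> traj f g'.
Proof. by move=> fg ff' i j; apply: straj_eq (ff' i j) => t /fg ->. Qed.

Lemma traj_cst m n (c : 'M[K]_(m, n)) : traj (fun=> c) (fun=> 0).
Proof. by move=> i j; apply: straj_eq (straj_cst _) => t _; rewrite mxE. Qed.

Lemma trajD m n (f g f' g' : K -> 'M[K]_(m, n)) : traj f f' -> traj g g' ->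
  traj (fun t => f t + g t) (fun t => f' t + g' t).
Proof.
move=> ff' gg' i j.
have -> : (fun t => (f t + g t) i j) = fun t => f t i j + g t i j.
  by apply/funext => t; rewrite mxE.
by apply: straj_eq (strajD (ff' i j) (gg' i j)) => t _; rewrite mxE.
Qed.

Lemma trajM m n p (f f' : K -> 'M[K]_(m, n)) (g g' : K -> 'M[K]_(n, p)) :
  traj f f' -> traj g g' ->
  traj (fun t => f t *m g t) (fun t => f' t *m g t + f t *m g' t).
Proof.
move=> ff' gg' i j.
have -> : (fun t => (f t *m g t) i j) = fun t => \sum_k f t i k * g t k j.
  by apply/funext => t; rewrite mxE.
apply: straj_eq (straj_sum _ (fun k => strajM (ff' i k) (gg' k j))) => t _.
by rewrite !mxE -big_split; apply: eq_bigr => k _; rewrite /= addrC [g t k j * _]mulrC.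
Qed.

Lemma traj_tr m n (f f' : K -> 'M[K]_(m, n)) : traj f f' ->
  traj (fun t => (f t)^T) (fun t => (f' t)^T).
Proof.
move=> ff' i j; have -> : (fun t => (f t)^T i j) = fun t => f t j i.
  by apply/funext => t; rewrite mxE.
by apply: straj_eq (ff' j i) => t _; rewrite mxE.
Qed.

Lemma trajMl m n p (c : 'M[K]_(m, n)) (f f' : K -> 'M[K]_(n, p)) : traj f f' ->
  traj (fun t => c *m f t) (fun t => c *m f' t).
Proof.
by move=> ff'; apply: traj_eq (trajM (traj_cst c) ff') => t _; rewrite mul0mx add0r.
Qed.

Lemma trajMr m n p (c : 'M[K]_(n, p)) (f f' : K -> 'M[K]_(m, n)) : traj f f' ->
  traj (fun t => f t *m c) (fun t => f' t *m c).
Proof.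
by move=> ff'; apply: traj_eq (trajM ff' (traj_cst c)) => t _; rewrite mulmx0 addr0.
Qed.

Lemma trajN m n (f f' : K -> 'M[K]_(m, n)) : traj f f' ->
  traj (fun t => - f t) (fun t => - f' t).
Proof.
move=> /(trajMl (- 1%:M)); have -> : (fun t => - 1%:M *m f t) = fun t => - f t.
  by apply/funext => t; rewrite mulNmx mul1mx.
by apply: traj_eq => t _; rewrite mulNmx mul1mx.
Qed.

Lemma trajB m n (f g f' g' : K -> 'M[K]_(m, n)) : traj f f' -> traj g g' ->
  traj (fun t => f t - g t) (fun t => f' t - g' t).
Proof. by move=> ff' gg'; apply: trajD ff' (trajN gg'). Qed.

Lemma traj_const m n (f f' : K -> 'M[K]_(m, n)) t : traj f f' ->
  (forall s : K, 0 < s -> f' s = 0) -> 0 <= t -> f t = f 0.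
Proof.
move=> ff' f'0 t0; apply/matrixP => i j; apply/eqP; rewrite eq_le.
rewrite (straj_nonincreasing (ff' i j) (lexx 0) t0) /=; last first.
  by move=> s /andP[s0 _]; rewrite f'0 // mxE.
rewrite -lerN2; have := straj_nonincreasing (trajN ff' i j) (lexx 0) t0.
by rewrite !mxE; apply => s /andP[s0 _]; rewrite f'0 // oppr0 mxE.
Qed.

Lemma traj_bounded m n (f f' : K -> 'M[K]_(m, n)) T : traj f f' -> 0 <= T ->
  exists2 c, 0 <= c & forall (t : K) i j, 0 <= t <= T -> `|f t i j| <= c.
Proof.
move=> ff' T0; have /choice [c cP] i : exists c, forall j (t : K), 0 <= t <= T -> `|f t i j| <= c.
  have /choice [c cP] j := straj_bounded (ff' i j) T0.
  exists (\sum_j `|c j|) => j t tT.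
  rewrite (bigD1 j) //= (le_trans (cP j t tT)) // (le_trans (ler_norm _)) //.
  by rewrite lerDl sumr_ge0.
exists (\sum_i `|c i|); first by rewrite sumr_ge0.
move=> t i j tT; rewrite (bigD1 i) //= (le_trans (cP i j t tT)) //.
by rewrite (le_trans (ler_norm _)) // lerDl sumr_ge0.
Qed.

(* Gronwall: the squared Frobenius norm [N] of [U] satisfies [N' <= C N]. *)
Lemma traj_linear_unique m n (U U' : K -> 'M[K]_(m, n)) (L L' : K -> 'M[K]_n) t :
  traj U U' -> traj L L' -> (forall s : K, 0 < s -> U' s = U s *m L s) ->
  U 0 = 0 -> 0 <= t -> U t = 0.
Proof.
move=> UU' LL' U'L U0 t0.
have [c c0 Lc] := traj_bounded LL' t0.
pose N s := \sum_i \sum_j U s i j * U s i j.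
have Nt : straj N (fun s => \sum_i \sum_j (U s i j * U' s i j + U s i j * U' s i j)).
  by do 2!apply: straj_sum => ?; apply: strajM.
(* [c] bounds the entries of [L]; one factor 2 comes from differentiating squares, and [n] from the
   sum over the inner index of the matrix product. *)
have := straj_exp_bound (c := c * n%:R *+ 2) Nt (lexx 0) t0.
have -> : N 0 = 0 by apply: big1 => i _; apply: big1 => j _; rewrite U0 mxE mul0r.
rewrite mulr0 => H.
have N0 i j : 0 <= U t i j * U t i j by rewrite -expr2 sqr_ge0.
have {H} : N t <= 0.
  apply: H => s /andP[s0 st]; rewrite /N mulr_sumr; apply: ler_sum => i _.
  have sT : 0 <= s <= t by rewrite !ltW.
  have bnd j : U s i j * U' s i j <= \sum_k c / 2 * (U s i j ^+ 2 + U s i k ^+ 2).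
    rewrite U'L // mxE mulr_sumr; apply: ler_sum => k _.
    have := Lc s k j sT; rewrite ler_norml => /andP[l1 l2].
    set x := U s i j; set y := U s i k; set l := L s k j.
    have h1 : 0 <= (x + y) ^+ 2 by exact: sqr_ge0.
    have h2 : 0 <= (x - y) ^+ 2 by exact: sqr_ge0.
    (* The two products add up to [2 c (x^2 + y^2) - 4 l x y >= 0]. *)
    have h3 := mulr_ge0 h1 (_ : 0 <= c - l); have h4 := mulr_ge0 h2 (_ : 0 <= c + l).
    have {h3} := h3 ltac:(by rewrite /l; lra); have {h4} := h4 ltac:(by rewrite /l; lra).
    by lra.
  rewrite big_split /= -mulr2n mulrnAl lerMn2r /=.
  apply: (le_trans (ler_sum _ (fun j _ => bnd j))).
  have sumE j : \sum_k c / 2 * (U s i j ^+ 2 + U s i k ^+ 2) =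
      c / 2 * (n%:R * U s i j ^+ 2 + \sum_k U s i k ^+ 2).
    by rewrite -mulr_sumr big_split /= sumr_const card_ord mulr_natl.
  rewrite (eq_bigr _ (fun j _ => sumE j)) -mulr_sumr big_split /= -mulr_sumr.
  rewrite sumr_const card_ord -mulr_natl.
  under [X in _ <= _ * X]eq_bigr do rewrite -expr2.
  by rewrite le_eqVlt; apply/orP; left; apply/eqP; field.
move=> Nt0; apply/matrixP => i j; rewrite mxE.
have : N t == 0 by rewrite eq_le Nt0 sumr_ge0 // => i' _; rewrite sumr_ge0.
rewrite psumr_eq0 => [/allP /(_ i (mem_index_enum _))|i' _]; last exact: sumr_ge0.
rewrite /= psumr_eq0 // => /allP /(_ j (mem_index_enum _)).
by rewrite /= mulf_eq0 orbb => /eqP.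
Qed.

Lemma cvg_mxP m n (T : Type) (F : set_system T) {FF : Filter F}
    (f : T -> 'M[K]_(m, n)) (l : 'M[K]_(m, n)) :
  f @ F --> l <-> forall i j, f x i j @[x --> F] --> l i j.
Proof.
split=> [fl i j A Al|fl A [P Pl PA]].
  apply: (fl [set M : 'M[K]_(m, n) | A (M i j)]).
  exists (fun i' j' => [set x | (i' == i) && (j' == j) -> A x]).
    move=> i' j'; have [[-> ->]|ne] := eqVneq (i', j') (i, j).
      by apply: filterS Al => x Ax.
    apply: filterS filterT => x _ /= /andP[/eqP e1 /eqP e2].
    by rewrite e1 e2 eqxx in ne.
  by move=> M /(_ i j); rewrite /= !eqxx; exact.
have : \forall x \near F, forall ij : 'I_m * 'I_n, P ij.1 ij.2 (f x ij.1 ij.2).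
  by apply: filter_forall => -[i j]; exact: fl (Pl i j).
by apply: filterS => x Px; apply: PA => i j; exact: (Px (i, j)).
Qed.

(** Continuity holds because [h] times the difference quotient tends to 0. For [t > 0] the
    constraint [0 <= t + h] holds for all small [h], so the derivative is two-sided. *)
Lemma has_derivative_traj n (f f' : K -> 'M[K]_n) :
  (forall t : K, 0 <= t -> has_derivative_from 0 f t (f' t)) -> traj f f'.
Proof.
move=> ff' i j.
have {}ff' t : 0 <= t ->
    h^-1 * (f (t + h) i j - f t i j) @[h --> within [set h | 0 <= t + h] 0^']
    --> f' t i j.
  move=> /ff' /cvg_mxP /(_ i j); apply: cvg_trans; apply: near_eq_cvg.
  by apply: nearW => h; rewrite !mxE.
split.
  apply/subspace_continuousP => t; rewrite /= in_itv /= andbT => t0.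
  apply/cvgrPdist_lt => e e0.
  have : h * (h^-1 * (f (t + h) i j - f t i j))
      @[h --> within [set h | 0 <= t + h] 0^'] --> 0 * f' t i j.
    apply: cvgM (ff' t t0).
    by move=> A A0; apply: filterS (nbhs_dnbhs A0).
  rewrite mul0r => /cvgrPdist_lt /(_ e e0).
  rewrite !near_withinE => /nbhs_ballP [d /= d0 H].
  apply/nbhs_ballP; exists d => //= x xt; rewrite in_itv /= andbT => x0.
  have [->|xnt] := eqVneq x t; first by rewrite subrr normr0.
  have := H (x - t); rewrite /ball /= sub0r normrN (addrC t) subrK => /(_ _).
  rewrite -normrN opprB => /(_ xt); rewrite subr_eq0 => /(_ xnt x0).
  by rewrite mulrA divff ?subr_eq0 // mul1r sub0r opprB.
move=> t t0.
have H : h^-1 *: (((fun t => f t i j) \o shift t) (h *: 1) - f t i j) @[h --> 0^']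
    --> f' t i j.
  have := ff' t (ltW t0).
  move=> H A /H; rewrite /= !near_simpl => HA.
  have : \forall h \near (0 : K)^', 0 <= t + h.
    apply/nbhs_ballP; exists t => //= h; rewrite /ball /= sub0r normrN => ht _.
    by move/ltr_normlP : ht => [h1 _]; lra.
  move: HA; rewrite near_withinE => HA Ht; apply: filterS2 Ht HA => h h0 /(_ h0).
  by rewrite /GRing.scale /= mulr1 (addrC h).
apply: DeriveDef; first by apply/cvg_ex; exists (f' t i j).
exact: cvg_lim H.
Qed.

(** Restarts the clock at [s]: as [a <= s], the constraint [0 <= t + h] implies [a <= s + t + h].
    Used with [a = 0] for the flow and [a = s] for the semigroup. *)
Lemma has_derivative_shift n (f : K -> 'M[K]_n) a s t l : a <= s ->
  has_derivative_from a f (s + t) l ->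
  has_derivative_from 0 (fun u => f (s + u)) t l.
Proof.
move=> as_ H A /H; apply: (@filterS _ ((0 : K)^')) => h /= HA h0.
by have := HA ltac:(lra); rewrite -addrA.
Qed.

End Matrix.
End Trajectories.

(** * The matrix exponential *)

Section Exponential.
Variables (K : realType) (n : nat).
Implicit Types M N B : 'M[K]_n.

Lemma cvg_mulmx m p q (T : Type) (F : set_system T) {FF : Filter F}
    (f : T -> 'M[K]_(m, p)) (g : T -> 'M[K]_(p, q)) (a : 'M[K]_(m, p))
    (b : 'M[K]_(p, q)) :
  f @ F --> a -> g @ F --> b -> (fun x => f x *m g x) @ F --> a *m b.
Proof.
move=> /cvg_mxP fa /cvg_mxP gb; apply/cvg_mxP => i j.
have sumE (s : seq 'I_p) : \sum_(k <- s) f x i k * g x k j @[x --> F]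
    --> \sum_(k <- s) a i k * b k j.
  elim: s => [|k s IH].
    by under eq_cvg do rewrite big_nil; rewrite big_nil; exact: cvg_cst.
  under eq_cvg do rewrite big_cons; rewrite big_cons.
  by apply: cvgD => //; apply: cvgM; [exact: fa | exact: gb].
under eq_cvg do rewrite mxE; rewrite mxE; exact: sumE.
Qed.

Lemma cvg_trmx m p (T : Type) (F : set_system T) {FF : Filter F}
    (f : T -> 'M[K]_(m, p)) (a : 'M[K]_(m, p)) :
  f @ F --> a -> (fun x => (f x)^T) @ F --> a^T.
Proof.
move=> /cvg_mxP fa; apply/cvg_mxP => i j.
under eq_cvg do rewrite mxE; rewrite mxE; exact: fa.
Qed.

Lemma cvg_mx_unique m p (T : Type) (F : set_system T) {FF : ProperFilter F}
    (f : T -> 'M[K]_(m, p)) (a b : 'M[K]_(m, p)) :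
  f @ F --> a -> f @ F --> b -> a = b.
Proof. by move=> fa fb; apply: (cvg_unique _ fa fb); exact: norm_hausdorff. Qed.

Lemma exprZmx t M k : (t *: M) ^+ k = t ^+ k *: M ^+ k.
Proof.
elim: k => [|k IH]; first by rewrite !expr0 scale1r.
by rewrite !exprS IH /GRing.mul /= -scalemxAl -scalemxAr scalerA.
Qed.

Lemma opboundX M b k : 0 <= b -> opbound M b -> opbound (M ^+ k) (b ^+ k).
Proof.
move=> b0 Mb; elim: k => [|k IH]; first by rewrite !expr0; exact: opbound1.
by rewrite !exprS; apply: opboundM.
Qed.

Lemma opbound_entry M b i j : opbound M b -> `|M i j| <= b.
Proof.
move=> Mb; have e1 (k : 'I_n) : eucl_norm (delta_mx k 0 : 'cV[K]_n) = 1.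
  rewrite eucl_normE vdotE (bigD1 k) //= big1 ?addr0 => [|l /negPf nl].
    by rewrite !mxE !eqxx mulr1 sqrtr1.
  by rewrite !mxE nl mul0r.
have -> : M i j = vdot (delta_mx i 0) (M *m delta_mx j 0).
  by rewrite /vdot trmx_delta -rowE -colE !mxE.
apply: (le_trans (cauchy_schwarz _ _)); rewrite e1 mul1r.
by apply: (le_trans (Mb _)); rewrite e1 mulr1.
Qed.

(** Power series coefficients of the entries of [N e^(xM)]. The factor [N] closes the family under
    differentiation, which replaces [N] by [N M]; one convergence lemma then covers the series and
    its derivatives. *)
Definition exp_entry N M i j (k : nat) : K := (N *m M ^+ k) i j / k`!%:R.

Lemma exp_entry_cvg N M i j x : cvgn (pseries (exp_entry N M i j) x).
Proof.
have [a a0 Na] := ex_opbound N; have [b b0 Mb] := ex_opbound M.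
apply: normed_cvg.
apply: (@series_le_cvg _ _ (fun k => a * exp_coeff (b * `|x|) k)).
- by move=> k /=.
- by move=> k; rewrite mulr_ge0 // exp_coeff_ge0 // mulr_ge0.
- move=> k /=; rewrite /exp_entry /exp_coeff /= !normrM normfV normrX.
  rewrite (ger0_norm (ler0n _ _)) exprMn mulrAC -!mulrA.
  have /(opbound_entry i j) := opboundM a0 Na (opboundX k b0 Mb).
  rewrite -subr_ge0 => h; rewrite -subr_ge0.
  have -> : a * (b ^+ k * (`|x| ^+ k * (k`!)%:R^-1)) -
      `|(N *m M ^+ k) i j| * (`|x| ^+ k / (k`!)%:R) =
      (a * b ^+ k - `|(N *m M ^+ k) i j|) * (`|x| ^+ k / (k`!)%:R) by ring.
  by rewrite mulr_ge0 // divr_ge0 // exprn_ge0.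
- apply: is_cvg_seriesZ; exact: is_cvg_series_exp_coeff.
Qed.

Lemma exp_entry_diffs N M i j :
  pseries_diffs (exp_entry N M i j) = exp_entry (N *m M) M i j.
Proof.
apply/funext => k; rewrite /pseries_diffs /exp_entry factS natrM exprS mulmxA.
by field; rewrite ?nat1r !pnatr_eq0 ?fact_gt0 -?lt0n ?fact_gt0.
Qed.

Lemma exp_entry_derive N M i j t :
  is_derive t (1 : K) (fun x => limn (pseries (exp_entry N M i j) x))
    (limn (pseries (exp_entry (N *m M) M i j) t)).
Proof.
rewrite -exp_entry_diffs; apply: (@pseries_snd_diffs _ _ (`|t| + 1)).
- exact: exp_entry_cvg.
- by rewrite exp_entry_diffs; exact: exp_entry_cvg.
- by rewrite !exp_entry_diffs; exact: exp_entry_cvg.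
- by rewrite [ltRHS]ger0_norm ?ltrDl // addr_ge0.
Qed.

Lemma expmx_series_entry M i j k :
  series (fun k => k`!%:R^-1 *: M ^+ k) k i j = pseries (exp_entry 1%:M M i j) 1 k.
Proof.
rewrite /series /= summxE; apply: eq_bigr => l _.
by rewrite /= /exp_entry mul1mx mxE expr1n mulr1 mulrC.
Qed.

Lemma expmx_cvg M : series (fun k => k`!%:R^-1 *: M ^+ k) @ \oo --> expmx M.
Proof.
apply/cvg_ex; exists (\matrix_(i, j) limn (pseries (exp_entry 1%:M M i j) 1)).
apply/cvg_mxP => i j; under eq_cvg do rewrite expmx_series_entry.
by rewrite mxE; exact: exp_entry_cvg.
Qed.

Arguments expmx_cvg : clear implicits.

Lemma exp_entry_lim N M i j t :
  limn (pseries (exp_entry N M i j) t) = (N *m expmx (t *: M)) i j.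
Proof.
apply: cvg_lim => //.
have := cvg_mulmx (@cvg_cst _ N _ \oo _) (expmx_cvg (t *: M)) => /(_ _ _).
move/cvg_mxP/(_ i j).
apply: cvg_trans; apply: near_eq_cvg; apply: nearW => k.
rewrite /series /= mulmx_sumr summxE; apply: eq_bigr => l _.
rewrite /= /exp_entry exprZmx -!scalemxAr mxE [X in _ * X = _]mxE.
by rewrite mulrCA [RHS]mulrC [_ / _]mulrC.
Qed.

Lemma expmx_comm M N : M *m N = N *m M -> M *m expmx N = expmx N *m M.
Proof.
move=> MN; have {}MN : GRing.comm M N by [].
apply: (cvg_mx_unique (cvg_mulmx (@cvg_cst _ M _ \oo _) (expmx_cvg N))).
apply: cvg_trans (cvg_mulmx (expmx_cvg N) (@cvg_cst _ M _ \oo _)).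
apply: near_eq_cvg; apply: nearW => k.
rewrite /series /= mulmx_sumr mulmx_suml; apply: eq_bigr => l _.
by rewrite -scalemxAr -scalemxAl; congr (_ *: _); exact/esym/(commrX l MN).
Qed.

Lemma expmx_commZ M t : M *m expmx (t *: M) = expmx (t *: M) *m M.
Proof. by apply: expmx_comm; rewrite -scalemxAl -scalemxAr. Qed.

Lemma expmx0 : expmx (0 : 'M[K]_n) = 1%:M.
Proof.
apply: (cvg_mx_unique (expmx_cvg 0)).
apply: cvg_near_cst; exists 1%N => // -[//|k] _ /=.
rewrite /series /= big_nat_recl // expr0 fact0 invr1 scale1r big1_seq ?addr0 //.
by move=> l _; rewrite exprS /GRing.mul /= mul0mx scaler0.
Qed.

Lemma expmx_tr M : expmx M^T = (expmx M)^T.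
Proof.
apply: (cvg_mx_unique (expmx_cvg M^T)).
apply: cvg_trans (cvg_trmx (expmx_cvg M)).
apply: near_eq_cvg; apply: nearW => k.
rewrite /series /= raddf_sum; apply: eq_bigr => l _; rewrite /= linearZ /=.
congr (_ *: _); elim: l => [|l IH]; first by rewrite !expr0 [LHS]trmx1.
by rewrite exprS exprSr /GRing.mul /= trmx_mul IH.
Qed.

Lemma expmx_traj M :
  traj (fun t => expmx (t *: M)) (fun t => M *m expmx (t *: M)).
Proof.
move=> i j; apply: straj_derivable => t.
have := exp_entry_derive 1%:M M i j t; rewrite exp_entry_lim mul1mx.
suff -> : (fun x => limn (pseries (exp_entry 1%:M M i j) x)) =
  fun t => expmx (t *: M) i j by [].
by apply/funext => x; rewrite exp_entry_lim mul1mx.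
Qed.

(** The product has zero derivative; [traj_const] gives constancy on the half-line, hence the sign
    condition. *)
Lemma expmx_inv M t : 0 <= t -> expmx (t *: M) *m expmx (t *: - M) = 1%:M.
Proof.
move=> t0; rewrite (traj_const (trajM (expmx_traj M) (expmx_traj (- M))) _ t0).
  by rewrite !scale0r expmx0 mulmx1.
by move=> s _; rewrite mulNmx mulmxN mulmxA expmx_commZ subrr.
Qed.

End Exponential.

(** * Exponential of a Hurwitz matrix *)

Section HurwitzDecay.
Variables (K : realType) (n : nat).
Implicit Types M N B U V : 'M[K]_n.

(* [f + i g] solves [y' = (a + i b) y + (u + i v)]. *)
Lemma oscillator_decay (f f' g g' u v : K -> K) a b : straj f f' -> straj g g' ->
  a < 0 ->
  (forall t : K, 0 < t -> f' t = a * f t - b * g t + u t) ->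
  (forall t : K, 0 < t -> g' t = a * g t + b * f t + v t) ->
  u t @[t --> +oo] --> (0 : K) -> v t @[t --> +oo] --> (0 : K) ->
  f t @[t --> +oo] --> (0 : K) /\ g t @[t --> +oo] --> (0 : K).
Proof.
move=> ff' gg' a0 f'E g'E u0 v0.
(* The derivative of [f^2 + g^2] is [2 a (f^2 + g^2) + 2 (f u + g v)], the rotation [b] cancelling.
   By Young's inequality the last term costs half of the decay plus [w]. *)
pose w t := (u t * u t + v t * v t) / - a.
have w0 : w t @[t --> +oo] --> (0 : K).
  rewrite -[X in _ --> X](_ : (0 * 0 + 0 * 0) / - a = 0); last by ring.
  by apply: cvgM; [apply: cvgD; exact: cvgM | exact: cvg_cst].
have H : f t * f t + g t * g t @[t --> +oo] --> (0 : K).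
  have Na : 0 < - a by rewrite oppr_gt0.
  apply: (straj_decay (strajD (strajM ff' ff') (strajM gg' gg')) Na _ w0).
    by move=> t; rewrite -!expr2 addr_ge0 // sqr_ge0.
  move=> t t0; rewrite /w f'E // g'E // -subr_ge0.
  have -> : - - a * (f t * f t + g t * g t) + (u t * u t + v t * v t) / - a -
    (f t * (a * f t - b * g t + u t) + f t * (a * f t - b * g t + u t) +
     (g t * (a * g t + b * f t + v t) + g t * (a * g t + b * f t + v t))) =
    ((a * f t + u t) ^+ 2 + (a * g t + v t) ^+ 2) / - a.
    by field; rewrite lt_eqF.
  by rewrite divr_ge0 ?(ltW Na) // addr_ge0 // sqr_ge0.
have sq (x y : K) e : 0 < e -> x * x + y * y < e * e -> `|x| < e.
  move=> e0 h; rewrite -(ltr_pXn2r (n := 2)) ?nnegrE ?(ltW e0) //.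
  rewrite real_normK ?num_real // !expr2; apply: le_lt_trans h.
  by rewrite lerDl -expr2 sqr_ge0.
split; apply/cvgrPdist_lt => e e0; move/cvgrPdist_lt: H => /(_ _ (mulr_gt0 e0 e0));
  apply: filterS => t; rewrite !sub0r !normrN => /(le_lt_trans (ler_norm _)).
  exact: sq.
by rewrite addrC; exact: sq.
Qed.

Definition exp_kills B U := expmx (t *: B) *m U @[t --> +oo] --> (0 : 'M[K]_n).

(* [U + i V] stands for a complex matrix, the hypotheses for its product with
   [B - (a + i b)]. *)
Lemma exp_kills_step B U V a b : a < 0 ->
  exp_kills B (B *m U - a *: U + b *: V) -> exp_kills B (B *m V - a *: V - b *: U) ->
  exp_kills B U /\ exp_kills B V.
Proof.
move=> a0 /cvg_mxP hu /cvg_mxP hv.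
suff H i j : (expmx (t *: B) *m U) i j @[t --> +oo] --> (0 : K) /\
    (expmx (t *: B) *m V) i j @[t --> +oo] --> (0 : K).
  by split; apply/cvg_mxP => i j; rewrite mxE; have [] := H i j.
pose u t := (expmx (t *: B) *m (B *m U - a *: U + b *: V)) i j.
pose v t := (expmx (t *: B) *m (B *m V - a *: V - b *: U)) i j.
apply: (oscillator_decay (trajMr U (expmx_traj B) i j)
  (trajMr V (expmx_traj B) i j) (a := a) (b := b) (u := u) (v := v) a0).
- move=> t _; rewrite /u mulmxDr mulmxBr -!scalemxAr expmx_commZ mulmxA !mxE; ring.
- move=> t _; rewrite /v !mulmxBr -!scalemxAr expmx_commZ mulmxA !mxE; ring.
- by have := hu i j; rewrite mxE.
- by have := hv i j; rewrite mxE.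
Qed.

Lemma ReD (x y : K[i]) : complex.Re (x + y) = complex.Re x + complex.Re y.
Proof. by case: x y => [? ?] [? ?]. Qed.

Lemma ImD (x y : K[i]) : complex.Im (x + y) = complex.Im x + complex.Im y.
Proof. by case: x y => [? ?] [? ?]. Qed.

Local Notation C := (map_mx (real_complex K)).

(* By Cayley-Hamilton the product of the [B - z], over the eigenvalues [z], is 0;
   the factors are removed one at a time by [exp_kills_step]. *)
Lemma hurwitz_cvg0 B : hurwitz B -> expmx (t *: B) @[t --> +oo] --> (0 : 'M[K]_n).
Proof.
move=> Bh; have [z zE] := closed_field_poly_normal (char_poly (C B)).
rewrite (monicP (char_poly_monic _)) scale1r in zE.
have zh w : w \in z -> complex.Re w < 0.
  move=> wz; apply: Bh; rewrite eigenvalue_root_char zE.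
  by rewrite root_prod_XsubC.
pose re (M : 'M[K[i]]_n) : 'M[K]_n := map_mx (@complex.Re K) M.
pose im (M : 'M[K[i]]_n) : 'M[K]_n := map_mx (@complex.Im K) M.
pose P s : 'M[K[i]]_n := \big[*%R/1]_(w <- s) (C B - w%:M).
have P0 : P z = 0.
  rewrite /P; case: (n) (B) zE => [|m] B' zE; first exact: flatmx0.
  have := Cayley_Hamilton (C B'); rewrite zE rmorph_prod /= => <-.
  by apply: eq_bigr => w _; rewrite rmorphB /= horner_mx_X horner_mx_C.
have reM (M : 'M[K[i]]_n) : re (C B *m M) = B *m re M.
  apply/matrixP => i j; rewrite !mxE (big_morph _ ReD (erefl _)).
  by apply: eq_bigr => k _; rewrite !mxE; case: (M k j) => x y /=; ring.
have imM (M : 'M[K[i]]_n) : im (C B *m M) = B *m im M.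
  apply/matrixP => i j; rewrite !mxE (big_morph _ ImD (erefl _)).
  by apply: eq_bigr => k _; rewrite !mxE; case: (M k j) => x y /=; ring.
have reB (X Q : 'M[K[i]]_n) w : re (X - w *: Q) =
    re X - complex.Re w *: re Q + complex.Im w *: im Q.
  apply/matrixP => i j; rewrite !mxE.
  by case: (X i j) (Q i j) w => [? ?] [? ?] [? ?] /=; ring.
have imB (X Q : 'M[K[i]]_n) w : im (X - w *: Q) =
    im X - complex.Re w *: im Q - complex.Im w *: re Q.
  apply/matrixP => i j; rewrite !mxE.
  by case: (X i j) (Q i j) w => [? ?] [? ?] [? ?] /=; ring.
have H s : exp_kills B (re (P s)) /\ exp_kills B (im (P s)) -> {subset s <= z} ->
    exp_kills B (re 1) /\ exp_kills B (im 1).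
  elim: s => [|w s IH] h sz; first by move: h; rewrite /P big_nil.
  apply: IH; last by move=> v vs; apply: sz; rewrite inE vs orbT.
  have w0 : complex.Re w < 0 by apply/zh/sz; rewrite mem_head.
  move: h; rewrite {1 2}/P !big_cons -/(P s).
  set Q := P s; have mulE (M : 'M[K[i]]_n) : (C B - w%:M) * M = C B *m M - w *: M.
    by rewrite /GRing.mul /= mulmxBl mul_scalar_mx.
  rewrite mulE => -[h1 h2].
  apply: (exp_kills_step (a := complex.Re w) (b := complex.Im w)) => //.
    by move: h1; rewrite reB reM.
  by move: h2; rewrite imB imM.
have [] := H z; last 1 first.
- move=> h _; move: h; have -> : re 1 = 1%:M.
    by apply/matrixP => i j; rewrite !mxE; case: eqP.
  by rewrite /exp_kills; under eq_cvg do rewrite mulmx1.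
- rewrite P0; have -> : re 0 = 0 by apply/matrixP => i j; rewrite !mxE.
  have -> : im 0 = 0 by apply/matrixP => i j; rewrite !mxE.
  by split; rewrite /exp_kills; under eq_cvg do rewrite mulmx0; exact: cvg_cst.
- by [].
Qed.

End HurwitzDecay.

(** * Sylvester and Lyapunov equations, Gramians *)

Lemma mx_entryD (K : realType) m n (M N : 'M[K]_(m, n)) i j : (M + N) i j = M i j + N i j.
Proof. exact: mxE. Qed.

Lemma mx_entryN (K : realType) m n (M : 'M[K]_(m, n)) i j : (- M) i j = - M i j.
Proof. exact: mxE. Qed.

Lemma mx_entry0 (K : realType) m n i j : (0 : 'M[K]_(m, n)) i j = 0.
Proof. exact: mxE. Qed.

Ltac mx_expand := rewrite ?(mulmxDl, mulmxDr, mulmxBl, mulmxBr, mulNmx, mulmxN,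
  opprK, mulmxA, mul1mx, mulmx1).

(* Linear arithmetic over noncommutative monomials, entry by entry. *)
Ltac mxlin := apply/matrixP => ? ?; rewrite ?(mx_entryD, mx_entryN); lra.
Ltac mxlin1 H := let i := fresh "i" in let j := fresh "j" in
  apply/matrixP => i j; move: (congr1 (fun X => fun_of_matrix X i j) H);
  rewrite ?(mx_entryD, mx_entryN, mx_entry0); lra.

Section Quadratic.
Variables (K : realType) (n : nat).
Implicit Types (M S E : 'M[K]_n) (x : 'cV[K]_n).

Lemma straj_quad (M M' : K -> 'M[K]_n) x : traj M M' ->
  straj (fun t => vdot x (M t *m x)) (fun t => vdot x (M' t *m x)).
Proof. by move=> /(trajMr x) /(trajMl x^T) /(_ 0 0). Qed.

Lemma quad_nondecreasing (M M' : K -> 'M[K]_n) x s t : traj M M' ->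
  (forall u : K, 0 < u -> psdmx (M' u)) -> 0 <= s -> s <= t ->
  vdot x (M s *m x) <= vdot x (M t *m x).
Proof.
move=> MM' M'p s0 st.
apply: (straj_nondecreasing (straj_quad x MM') s0 st) => u /andP[su _].
exact/psd_vdot_ge0/M'p/(le_lt_trans s0).
Qed.

Lemma psd_congr S E : psdmx S -> psdmx (E^T *m S *m E).
Proof.
move=> Sp; split=> [|x]; first by rewrite !trmx_mul trmxK Sp.1 mulmxA.
by rewrite quadE -!mulmxA vdot_mulmx trmxK psd_vdot_ge0.
Qed.

Lemma quad_cvg (M : K -> 'M[K]_n) (L : 'M[K]_n) x : M t @[t --> +oo] --> L ->
  vdot x (M t *m x) @[t --> +oo] --> vdot x (L *m x).
Proof.
move=> ML; have H : x^T *m (M t *m x) @[t --> +oo] --> x^T *m (L *m x).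
  exact: (cvg_mulmx (cvg_cst x^T) (cvg_mulmx ML (cvg_cst x))).
by move/cvg_mxP: H => /(_ 0 0).
Qed.

Lemma cvgy_ge (f : K -> K) l c T : f t @[t --> +oo] --> l ->
  (forall t : K, T < t -> c <= f t) -> c <= l.
Proof.
move=> fl cf; rewrite -(cvg_lim _ fl) //; apply: limr_ge; first by apply/cvg_ex; exists l.
by exists T; split; first exact: num_real.
Qed.

Lemma straj_locally_const (f f' : K -> K) a b s c : straj f f' -> 0 <= a ->
  (forall t : K, a < t < b -> f t = c) -> a < s < b -> f' s = 0.
Proof.
move=> [_ df] a0 fc /andP[as_ sb]; have ds := df s (le_lt_trans a0 as_).
rewrite -(@derive_val _ _ _ _ _ _ _ ds).
rewrite -(derive_cst (V := K) c s 1); apply: near_eq_derive.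
have : s \in `]a, b[ by rewrite in_itv /= as_.
by move=> /near_in_itvoo; apply: filterS => t; rewrite in_itv; exact: fc.
Qed.

End Quadratic.

(** * Sylvester and Lyapunov equations of a stable matrix, and its Gramian *)

Section Lyapunov.
Variables (K : realType) (n : nat).
Implicit Types (A B S G X : 'M[K]_n) (x : 'cV[K]_n).

Definition stable B := expmx (t *: B) @[t --> +oo] --> (0 : 'M[K]_n).

Lemma expmx_trZ B t : expmx (t *: B^T) = (expmx (t *: B))^T.
Proof. by rewrite -expmx_tr linearZ. Qed.

Lemma stable_tr B : stable B -> stable B^T.
Proof.
move=> Bs; rewrite /stable; under eq_cvg do rewrite expmx_trZ.
by rewrite -[0]trmx0; exact: cvg_trmx.
Qed.

Lemma traj_congr B X :
  traj (fun t => (expmx (t *: B))^T *m X *m expmx (t *: B))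
    (fun t => (expmx (t *: B))^T *m (B^T *m X + X *m B) *m expmx (t *: B)).
Proof.
apply: traj_eq (trajM (trajMr X (traj_tr (expmx_traj B))) (expmx_traj B)) => t _.
by rewrite trmx_mul; mx_expand.
Qed.

(** [e^(tB1) X e^(tB2)'] has zero derivative, equals [X] at 0 and tends to 0. *)
Lemma sylvester_unique B1 B2 X : stable B1 -> stable B2 ->
  B1 *m X + X *m B2^T = 0 -> X = 0.
Proof.
move=> s1 s2 X0; pose F t := expmx (t *: B1) *m X *m (expmx (t *: B2))^T.
have F0 : F t @[t --> +oo] --> (0 : 'M[K]_n).
  have H : F t @[t --> +oo] --> 0 *m X *m (0 : 'M[K]_n)^T.
    exact: (cvg_mulmx (cvg_mulmx s1 (cvg_cst X)) (cvg_trmx s2)).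
  by rewrite !mul0mx in H.
have Ft : traj F (fun t => 0).
  apply: traj_eq (trajM (trajMr X (expmx_traj B1)) (traj_tr (expmx_traj B2))) => t _.
  have := congr1 (fun Y => expmx (t *: B1) *m Y *m (expmx (t *: B2))^T) X0.
  by rewrite mulmx0 mul0mx expmx_commZ (expmx_commZ B2) trmx_mul; mx_expand.
apply: (cvg_mx_unique _ F0); apply: cvg_near_cst; exists 0; split; first exact: num_real.
move=> t t0; rewrite (traj_const Ft _ (ltW t0)) //.
by rewrite /F !scale0r expmx0 mul1mx trmx1 mulmx1.
Qed.

(** Uniqueness gives existence: the Lyapunov operator is an injective endomorphism of a
    finite-dimensional space. *)
Lemma lyapunov_solution B S : stable B ->
  exists G, B^T *m G + G *m B = S.
Proof.
move=> Bs; pose L := lin_mx (mulmx B^T \+ mulmxr B).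
have LE X : mxvec X *m L = mxvec (B^T *m X + X *m B) by rewrite mul_vec_lin.
have Lu : L \in unitmx.
  rewrite -row_free_unit -kermx_eq0; apply/eqP/row_matrixP => i; rewrite row0.
  have := mulmx_ker L; move=> /(congr1 (row i)); rewrite row0 row_mul.
  rewrite -[row i _]vec_mxK LE => /(congr1 vec_mx); rewrite mxvecK linear0.
  move=> X0; rewrite (sylvester_unique (stable_tr Bs) (stable_tr Bs) (X := vec_mx _)).
    by rewrite linear0.
  by rewrite trmxK.
exists (vec_mx (mxvec S *m invmx L)); apply: (can_inj mxvecK).
by rewrite -LE vec_mxK mulmxKV.
Qed.

Section Solution.
Variables B S G : 'M[K]_n.
Hypotheses (Bs : stable B) (Sp : psdmx S) (BG : B^T *m G + G *m B = - S).

Local Notation e t := (expmx (t *: B)).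

(** Closed form of [S_t]: by the equation for [G], the function [- e(u)' G e(u)] is a primitive of
    [e(u)' S e(u)]. [gramianE] makes the link with the integral. *)
Definition gram t := G - (e t)^T *m G *m e t.

Lemma gram_traj : traj gram (fun t => (e t)^T *m S *m e t).
Proof.
apply: traj_eq (trajB (traj_cst G) (traj_congr B G)) => t _.
by rewrite BG sub0r; mx_expand.
Qed.

Lemma gram0 : gram 0 = 0.
Proof. by rewrite /gram scale0r expmx0 trmx1 mul1mx mulmx1 subrr. Qed.

Lemma straj_RintegralE (f f' : K -> K) t : straj f f' ->
  {within `[0, +oo[, continuous f'} -> 0 <= t ->
  \int[lebesgue_measure]_(u in `[0, t]) f' u = f t - f 0.
Proof.
move=> [cf df] cf'; rewrite le_eqVlt => /predU1P[<-|t0].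
  by rewrite set_itv1 Rintegral_set1 subrr.
have sub : `[0, t] `<=` `[0, +oo[.
  by move=> u /=; rewrite !in_itv /= andbT => /andP[].
have /continuous_within_itvP [//|c1 c2 c3] := continuous_subspaceW sub cf.
rewrite /Rintegral (@continuous_FTC2 _ _ f) //.
- exact: continuous_subspaceW cf'.
- split => // u; rewrite in_itv /= => /andP[u0 _].
  exact: (@ex_derive _ _ _ _ _ _ _ (df u u0)).
- move=> u; rewrite in_itv /= => /andP[u0 _]; rewrite derive1E.
  exact: (@derive_val _ _ _ _ _ _ _ (df u u0)).
Qed.

Lemma gramianE t : 0 <= t -> gramian B S t = gram t.
Proof.
move=> t0; apply/matrixP => i j; rewrite mxE.
under eq_Rintegral do rewrite expmx_trZ.
rewrite (straj_RintegralE (gram_traj i j) _ t0); first by rewrite gram0 [X in _ - X]mxE subr0.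
exact: (traj_congr B S i j).1.
Qed.

Lemma gram_cvg : gram t @[t --> +oo] --> G.
Proof.
have H : (e t)^T *m G *m e t @[t --> +oo] --> (0 : 'M[K]_n).
  have H : (e t)^T *m G *m e t @[t --> +oo] --> (0 : 'M[K]_n)^T *m G *m 0.
    exact: (cvg_mulmx (cvg_mulmx (cvg_trmx Bs) (cvg_cst G)) Bs).
  by rewrite mulmx0 in H.
apply/cvg_mxP => i j; move/cvg_mxP: H => /(_ i j).
rewrite mxE => H; rewrite -[G i j]subr0; under eq_cvg do rewrite mx_entryD mx_entryN.
by apply: cvgB H; exact: cvg_cst.
Qed.

Lemma gramian_inftyE : gramian_infty B S = G.
Proof.
apply: cvg_lim; first exact: norm_hausdorff.
apply: cvg_trans gram_cvg; apply: near_eq_cvg; exists 0; split; first exact: num_real.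
by move=> t /ltW t0; rewrite /= gramianE.
Qed.

Lemma lyapunov_sym : G^T = G.
Proof.
apply/eqP; rewrite -subr_eq0; apply/eqP.
apply: (sylvester_unique (stable_tr Bs) (stable_tr Bs)).
have := congr1 trmx BG; rewrite linearD /= !trmx_mul trmxK linearN /= Sp.1.
rewrite ?trmxK -BG; mx_expand => H; mxlin1 H.
Qed.

Lemma gram_sym t : (gram t)^T = gram t.
Proof. by rewrite /gram linearB /= !trmx_mul trmxK lyapunov_sym mulmxA. Qed.

Lemma quad_congr M t x :
  vdot x ((e t)^T *m M *m e t *m x) = vdot (e t *m x) (M *m (e t *m x)).
Proof. by rewrite -!mulmxA vdot_mulmx trmxK. Qed.

Lemma gram_le s t x : 0 <= s -> s <= t ->
  vdot x (gram s *m x) <= vdot x (gram t *m x).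
Proof. by apply: (quad_nondecreasing x gram_traj) => u _; exact: psd_congr. Qed.

Lemma gram_le_lyapunov t x : 0 <= t -> vdot x (gram t *m x) <= vdot x (G *m x).
Proof.
move=> t0; have H := quad_cvg (x := x) gram_cvg.
apply: (cvgy_ge (T := t) H) => u /ltW tu.
exact: (gram_le x t0 tu).
Qed.

Lemma gram_psd t : 0 <= t -> psdmx (gram t).
Proof.
move=> t0; split=> [|x]; first exact: gram_sym.
by rewrite quadE; have := gram_le x (lexx 0) t0; rewrite gram0 mul0mx vdot0r.
Qed.

Hypothesis obs : forall y : 'cV[K]_n, (forall k, S *m B ^+ k *m y = 0) -> y = 0.

(* If [x' (gram t) x = 0] then [S e^(sB) x] vanishes on [0, t], and so do its
   derivatives [S B^k e^(sB) x]. *)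
Lemma gram_pd t : 0 < t -> pdmx (gram t).
Proof.
move=> t0; split=> [|x x0]; first exact: gram_sym.
rewrite quadE lt_neqAle psd_vdot_ge0 ?andbT; last exact/gram_psd/ltW.
apply/eqP => /esym xt; move/eqP: x0; apply.
have gx s : 0 < s < t -> vdot x (gram s *m x) = 0.
  move=> /andP[s0 st]; apply/eqP; rewrite eq_le; apply/andP; split.
    by rewrite -xt; apply: gram_le; exact: ltW.
  exact/psd_vdot_ge0/gram_psd/ltW.
have Sk k s : 0 < s < t -> S *m B ^+ k *m (e s *m x) = 0.
  elim: k s => [|k IH] s st.
    rewrite expr0 mulmx1; apply: psd_ker => //; rewrite -quad_congr.
    exact: (straj_locally_const (straj_quad x gram_traj) (lexx 0) gx st).
  have T := trajMl (S *m B ^+ k) (trajMr x (expmx_traj B)).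
  have -> : S *m B ^+ k.+1 *m (e s *m x) = S *m B ^+ k *m (B *m e s *m x).
    by rewrite exprSr -[B ^+ k * B]/(B ^+ k *m B) !mulmxA.
  apply/matrixP => i j; rewrite [RHS]mxE.
  apply: (straj_locally_const (c := 0) (T i j) (lexx 0) _ st) => u ut.
  by rewrite IH // mxE.
(* At one interior time, observability gives [e^(tB/2) x = 0], and the exponential is invertible. *)
have h : 0 < t / 2 < t by apply/andP; split; lra.
have y0 : e (t / 2) *m x = 0 by apply: obs => k; exact: Sk.
have /mulmx1C := expmx_inv B (ltW (andP h).1).
move=> /(congr1 (mulmx^~ x)); rewrite mul1mx => <-.
by rewrite -mulmxA y0 mulmx0.
Qed.

Lemma lyapunov_pd : pdmx G.
Proof.
split=> [|x x0]; first exact: lyapunov_sym.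
rewrite quadE; apply: lt_le_trans (gram_le_lyapunov x ler01).
by have := (gram_pd ltr01).2 x x0; rewrite quadE.
Qed.

End Solution.
End Lyapunov.

(** * The stabilizing solution and the Floquet representation *)

Section Algebraic.
Variables (K : realType) (r : nat).
Implicit Types (A B R S P G X D : 'M[K]_r) (x y z : 'cV[K]_r).

Lemma trmx_sub A B : (A - B)^T = A^T - B^T.
Proof. exact: linearB. Qed.

Lemma riccati_closed_loop A R S P : P^T = P -> S^T = S -> riccati A R S P = 0 ->
  (A - P *m S) *m P + P *m (A - P *m S)^T + R + P *m S *m P = 0.
Proof.
move=> Ps Ss; rewrite trmx_sub trmx_mul Ps Ss /riccati => H.
by mx_expand; mxlin1 H.
Qed.

(** Feedback does not change the unobservable space: [B = A - P S] agrees with [A] on vectors killed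
    by [S], so [A^k y = B^k y] by induction. [S] and its root have the same kernel, as
    [|rootS z|^2 = <z, S z>]. *)
Lemma observable_closed_loop A S rootS P y : rootS^T = rootS -> rootS *m rootS = S ->
  observable A rootS -> (forall k, S *m (A - P *m S) ^+ k *m y = 0) -> y = 0.
Proof.
move=> rs rS obs Sy; set B := A - P *m S in Sy.
have rk z : S *m z = 0 -> rootS *m z = 0.
  move=> Sz; apply/eqP; rewrite -vdot_eq0 -{1}rs -vdot_mulmx mulmxA rS Sz.
  by rewrite vdot0r.
have Ak k : A ^+ k *m y = B ^+ k *m y.
  elim: k => [|k IH]; first by rewrite !expr0.
  rewrite !exprS -![_ * _]/(_ *m _) -!mulmxA IH.
  have -> : B = A - P *m S by [].
  by rewrite mulmxBl -[P *m S *m _]mulmxA [S *m _]mulmxA Sy mulmx0 subr0.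
have My : \mxcol_(i < r) (rootS *m A ^+ i) *m y = 0.
  rewrite mxcol_mul; apply/eqP; rewrite -[0]mxcol0; apply/eqP/eq_mxcol => i.
  by rewrite -mulmxA Ak; apply: rk; rewrite mulmxA Sy.
have /row_fullP [L LM] : row_full (\mxcol_(i < r) (rootS *m A ^+ i)) by apply/eqP.
by rewrite -[y]mul1mx -LM -mulmxA My mulmx0.
Qed.

(** By transposition [y'] annihilates the controllability matrix, whose rows are independent. *)
Lemma controllable_krylov A rootR y : controllable A rootR ->
  rootR^T = rootR -> (forall k, rootR *m A^T ^+ k *m y = 0) -> y = 0.
Proof.
move=> ctr rr Ry.
have trX k : (A ^+ k)^T = A^T ^+ k.
  elim: k => [|k IH]; first by rewrite !expr0 trmx1.
  by rewrite exprS exprSr -![_ * _]/(_ *m _) trmx_mul IH.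
have yM : y^T *m \mxrow_(i < r) (A ^+ i *m rootR) = 0.
  rewrite mul_mxrow; apply/eqP; rewrite -[0]mxrow0; apply/eqP/eq_mxrow => i.
  by apply: trmx_inj; rewrite !trmx_mul trmxK rr trX Ry trmx0.
apply: trmx_inj; rewrite trmx0; apply/eqP.
have rf : row_free (\mxrow_(i < r) (A ^+ i *m rootR)) by apply/eqP.
by rewrite -(mulmx_free_eq0 _ rf) yM.
Qed.

(** Multiply the Riccati equation by [G] on both sides and eliminate [B'G] and [G B]. For symmetric
    [P] and [G] the right side is minus a sum of two psd congruences; the one with [R] lets
    controllability in. *)
Lemma lyapunov_riccati B R S P G : B^T *m G + G *m B = - S ->
  B *m P + P *m B^T + R + P *m S *m P = 0 ->
  B^T *m (G - G *m P *m G) + (G - G *m P *m G) *m B =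
  - ((1%:M - G *m P) *m S *m (1%:M - P *m G) + G *m R *m G).
Proof.
move=> BG PB.
have H := congr1 (fun X => G *m X *m G) PB; rewrite mulmx0 mul0mx in H.
have H1 := congr1 (fun X => X *m P *m G) BG.
have H2 := congr1 (fun X => G *m P *m X) BG.
move: H H1 H2; mx_expand => H H1 H2; apply/matrixP => i j.
move: (congr1 (fun X => fun_of_matrix X i j) H)
  (congr1 (fun X => fun_of_matrix X i j) H1)
  (congr1 (fun X => fun_of_matrix X i j) H2)
  (congr1 (fun X => fun_of_matrix X i j) BG).
by rewrite ?(mx_entryD, mx_entryN, mx_entry0); lra.
Qed.

(* By [lyapunov_riccati], [Y = G - G P G] satisfies [B'Y + YB <= 0], so it is psd as
   [e^(tB)] tends to 0. Its kernel is [B]-invariant and, as [A'G = - G B] on it, [G]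
   maps it into the unobservable space of [(A', R)]. *)
Lemma Pinfty_minus_pd A R S rootR P G : psdmx R -> psdmx S ->
  rootR^T = rootR -> rootR *m rootR = R -> controllable A rootR ->
  pdmx P -> riccati A R S P = 0 -> stable (A - P *m S) ->
  (A - P *m S)^T *m G + G *m (A - P *m S) = - S -> pdmx G ->
  pdmx (invmx G - P).
Proof.
move=> Rp Sp rr rR ctr Pp Peq Bs BG Gp; set B := A - P *m S in Bs BG.
have Ps := Pp.1; have Gs := Gp.1; have Gu := pd_unit Gp.
have PB := riccati_closed_loop Ps Sp.1 Peq; rewrite -/B in PB.
(* [Y = G (G^-1 - P) G] is congruent to the target and free of the inverse. *)
pose Y := G - G *m P *m G.
have Ys : Y^T = Y by rewrite /Y trmx_sub !trmx_mul Gs Ps mulmxA.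
pose W := (1%:M - P *m G)^T *m S *m (1%:M - P *m G) + G^T *m R *m G.
have BY : B^T *m Y + Y *m B = - W.
  by rewrite /W [(1%:M - _)^T]trmx_sub trmx1 [(P *m G)^T]trmx_mul Ps Gs; exact: lyapunov_riccati.
have Wp : psdmx W.
  have Wx x : vdot x (W *m x) = vdot x ((1%:M - P *m G)^T *m S *m (1%:M - P *m G) *m x)
    + vdot x (G^T *m R *m G *m x) by rewrite /W mulmxDl vdotDr.
  split=> [|x]; last by rewrite quadE Wx addr_ge0 // psd_vdot_ge0 //; exact: psd_congr.
  by rewrite /W linearD /= (psd_congr _ Sp).1 (psd_congr _ Rp).1.
have Yp : psdmx Y.
  split=> // x; rewrite quadE -[X in 0 <= X]opprK oppr_ge0.
  have T := straj_quad x (trajN (traj_congr B Y)).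
  have L : vdot x (- ((expmx (t *: B))^T *m Y *m expmx (t *: B)) *m x) @[t --> +oo]
      --> (0 : K).
    have H : - ((expmx (t *: B))^T *m Y *m expmx (t *: B)) @[t --> +oo]
        --> - ((0 : 'M[K]_r)^T *m Y *m 0).
      by apply: cvgN; exact: (cvg_mulmx (cvg_mulmx (cvg_trmx Bs) (cvg_cst Y)) Bs).
    by have := quad_cvg (x := x) H; rewrite mulmx0 oppr0 mul0mx vdot0r.
  have -> : - vdot x (Y *m x) =
      vdot x (- ((expmx (0 *: B))^T *m Y *m expmx (0 *: B)) *m x).
    by rewrite scale0r expmx0 trmx1 mul1mx mulmx1 mulNmx vdotNr.
  apply: (cvgy_ge (T := 0) L) => t /ltW t0.
  apply: (straj_nondecreasing T (lexx 0) t0) => s _.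
  by rewrite BY mulmxN [- _ *m expmx _]mulNmx opprK; apply/psd_vdot_ge0/psd_congr.
have kY z : Y *m z = 0 -> rootR *m (G *m z) = 0 /\ Y *m (B *m z) = 0.
  move=> Yz.
  have Wz : W *m z = 0.
    apply: psd_ker => //; rewrite -[W]opprK -BY mulNmx vdotNr mulmxDl vdotDr.
    rewrite -mulmxA Yz mulmx0 vdot0r add0r -mulmxA vdot_mulmx Ys Yz.
    by rewrite vdotC vdot0r oppr0.
  split; last first.
    have := congr1 (mulmx^~ z) BY.
    by rewrite mulmxDl mulNmx Wz -!mulmxA Yz mulmx0 add0r oppr0.
  have : vdot z (W *m z) == 0 by rewrite Wz vdot0r.
  rewrite /W mulmxDl vdotDr paddr_eq0; last 2 first.
    exact/psd_vdot_ge0/psd_congr.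
    exact/psd_vdot_ge0/psd_congr.
  move=> /andP[_ /eqP]; rewrite -rR -!mulmxA vdot_mulmx trmxK => h.
  apply/eqP; rewrite -vdot_eq0 -{1}rr -vdot_mulmx; exact/eqP.
(* On the kernel [z = P G z], so [A'G z = B'G z + S z], which the equation for [G] turns into
   [- G B z]. *)
have AG z : Y *m z = 0 -> A^T *m (G *m z) = G *m - (B *m z).
  rewrite /Y mulmxBl => /subr0_eq Gz.
  have z1 : z = P *m G *m z.
    by apply: (can_inj (mulKmx Gu)); rewrite !mulmxA.
  have -> : A^T = B^T + S *m P by rewrite /B trmx_sub trmx_mul Ps Sp.1 subrK.
  have := congr1 (mulmx^~ z) BG; rewrite mulmxN mulmxDl mulNmx => H.
  rewrite mulmxDl -[S *m P *m _]mulmxA [P *m _]mulmxA -z1.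
  by apply/eqP; rewrite !mulmxA -subr_eq0 opprK addrAC H addNr.
have Yi z : Y *m z = 0 -> z = 0.
  move=> Yz; suff Gz : G *m z = 0 by rewrite -[z]mul1mx -(mulVmx Gu) -mulmxA Gz mulmx0.
  apply: (controllable_krylov ctr rr) => k; elim: k z Yz => [|k IH] z Yz.
    by rewrite expr0 mulmx1; have [] := kY z Yz.
  rewrite exprSr -[_ * _]/(_ *m _) -!mulmxA AG // mulmxA; apply: IH.
  by rewrite mulmxN (kY z Yz).2 oppr0.
have NY x : vdot x ((invmx G - P) *m x) = vdot (invmx G *m x) (Y *m (invmx G *m x)).
  rewrite -{2}(invmx_sym Gs) -vdot_mulmx; congr vdot; rewrite /Y !mulmxA; congr mulmx.
  by mx_expand; rewrite mulVmx // !mul1mx -mulmxA mulmxV // mulmx1.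
split=> [|x x0]; first by rewrite trmx_sub Ps invmx_sym.
rewrite quadE NY lt_neqAle psd_vdot_ge0 // andbT; apply/eqP => /esym.
move=> /(psd_ker Yp) /Yi y0; move/eqP: x0; apply.
by rewrite -[x]mul1mx -(mulmxV Gu) -mulmxA y0 mulmx0.
Qed.

(** With one closed loop on each side, the cross terms [P1 S P2] cancel:
    [B1 (P1 - P2) + (P1 - P2) B2'] is the difference of the two Riccati expressions, hence 0. *)
Lemma riccati_fixpoint_unique A R S P1 P2 : psdmx S ->
  is_riccati_fixpoint A R S P1 -> is_riccati_fixpoint A R S P2 -> P1 = P2.
Proof.
move=> Sp [p1 e1 h1] [p2 e2 h2]; apply: subr0_eq.
apply: (sylvester_unique (hurwitz_cvg0 h1) (hurwitz_cvg0 h2)).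
rewrite trmx_sub trmx_mul p2.1 Sp.1.
move: e1 e2; rewrite /riccati; mx_expand => e1 e2; apply/matrixP => i j.
move: (congr1 (fun X => fun_of_matrix X i j) e1) (congr1 (fun X => fun_of_matrix X i j) e2).
by rewrite ?(mx_entryD, mx_entryN, mx_entry0); lra.
Qed.

End Algebraic.

(** * Explicit form of the semigroup and of the flow around the fixed point *)

Section Floquet.
Variables (K : realType) (r : nat) (B S G : 'M[K]_r) (D X : K -> 'M[K]_r).
Hypothesis BG : B^T *m G + G *m B = - S.
Hypothesis Dt : traj D (fun t => B *m D t + D t *m B^T - D t *m S *m D t).
Hypothesis Xt : traj X (fun t => (B - D t *m S) *m X t).
Hypothesis X0 : X 0 = 1%:M.

Local Notation e t := (expmx (t *: B)).
Local Notation f t := (expmx (t *: - B)).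
(* [Z t] is the inverse of [X t]. *)
Let Z t := (1%:M + D 0 *m gram B G t) *m f t.

Let Zt : traj Z (fun t => D 0 *m (e t)^T *m S - Z t *m B).
Proof.
apply: traj_eq (trajM (trajD (traj_cst 1%:M) (trajMl (D 0) (gram_traj BG)))
  (expmx_traj (- B))) => t /ltW t0.
rewrite expmx_commZ mulmxN mulmxN add0r /Z; congr (_ - _); last by rewrite !mulmxA.
by rewrite -!mulmxA expmx_inv // mulmx1.
Qed.

Lemma floquet_riccati t : 0 <= t -> Z t *m D t = D 0 *m (e t)^T.
Proof.
move=> t0; apply: subr0_eq.
have Ut := trajB (trajM Zt Dt) (trajMl (D 0) (traj_tr (expmx_traj B))).
(* The difference [U] of the two sides satisfies [U' = U (B' - S D)] and [U 0 = 0]; the terms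
   [Z B D] have cancelled. *)
have Lt := trajB (traj_cst B^T) (trajMl S Dt).
apply: (traj_linear_unique Ut Lt _ _ t0) => [s _|].
  by rewrite trmx_mul; mx_expand; mxlin.
by rewrite /Z !scale0r !expmx0 gram0 mulmx0 addr0 trmx1 !mulmx1 mul1mx subrr.
Qed.

Lemma floquet_inverse t : 0 <= t -> Z t *m X t = 1%:M.
Proof.
move=> t0; rewrite (traj_const (trajM Zt Xt) _ t0).
  by rewrite X0 /Z gram0 mulmx0 addr0 scale0r expmx0 !mulmx1.
(* The derivative of [Z X] is [(D_0 e(s)' - Z D) S X], which is 0 by [floquet_riccati]. *)
move=> s /ltW s0; have := congr1 (fun M => M *m S *m X s) (floquet_riccati s0).
by mx_expand => H; mxlin1 H.
Qed.

Lemma floquet t : 0 <= t -> X t *m (1%:M + D 0 *m gram B G t) = e t.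
Proof.
move=> t0; have /mulmx1C := floquet_inverse t0.
move=> /(congr1 (mulmx^~ (e t))); rewrite mul1mx /Z !mulmxA => <-.
by rewrite -[RHS]mulmxA (mulmx1C (expmx_inv B t0)) mulmx1.
Qed.

Lemma floquet_flow t : 0 <= t -> D t = X t *m D 0 *m (e t)^T.
Proof.
move=> t0; have /mulmx1C XZ := floquet_inverse t0.
by rewrite -mulmxA -floquet_riccati // mulmxA XZ mul1mx.
Qed.

End Floquet.

(** * Uniform estimates *)

Section Estimates.
Variables (K : realType) (r : nat).
Implicit Types (A B R S P Q G M D W X : 'M[K]_r) (x y z : 'cV[K]_r).

(** Entries are below 1 past some time by decay and at most [c] before it by compactness, so [c + 1]
    serves throughout. *)
Lemma stable_bounded B : stable B ->
  exists2 c, 1 <= c & forall t : K, 0 <= t -> opbound (expmx (t *: B)) c.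
Proof.
move=> /cvg_mxP Bs.
have [T [_ BT]] : \forall t \near +oo, forall i j, `|expmx (t *: B) i j| < 1.
  apply: filter_forall => i; apply: filter_forall => j.
  move/cvgrPdist_lt: (Bs i j) => /(_ 1 ltr01); apply: filterS => t.
  by rewrite mxE sub0r normrN.
have T0 : 0 <= Num.max T 0 by rewrite le_max lexx orbT.
have [c c0 Bc] := traj_bounded (expmx_traj B) T0.
exists (1 + Num.sqrt (\sum_(i < r) \sum_(j < r) (c + 1) ^+ 2)).
  by rewrite lerDl sqrtr_ge0.
move=> t t0; apply: opbound_le (opbound_frobenius _).
apply: (@le_trans _ _ (Num.sqrt (\sum_(i < r) \sum_(j < r) (c + 1) ^+ 2))).
  apply: ler_wsqrtr; apply: ler_sum => i _; apply: ler_sum => j _.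
  rewrite -(real_normK (num_real _)) ler_pXn2r ?nnegrE ?addr_ge0 //.
  have [tT|tT] := leP t (Num.max T 0).
    by rewrite (le_trans (Bc t i j _)) ?t0 // lerDl.
  have /BT/(_ i j)/ltW h : T < t by apply: le_lt_trans tT; rewrite le_max lexx.
  by rewrite (le_trans h) // lerDr.
by rewrite lerDr.
Qed.

(** The exact second-order expansion of the quadratic map [riccati] at its zero [P]. *)
Lemma riccati_shift A R S P F : P^T = P -> S^T = S -> riccati A R S P = 0 ->
  riccati A R S F = (A - P *m S) *m (F - P) + (F - P) *m (A - P *m S)^T
    - (F - P) *m S *m (F - P).
Proof.
move=> Ps Ss; rewrite /riccati trmx_sub trmx_mul Ps Ss; mx_expand => H.
by mxlin1 H.
Qed.

Section Resolvent.
Variables (M D : 'M[K]_r) (l : K).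
Hypotheses (Mp : pdmx M) (Ds : D^T = D) (l0 : 0 < l) (MD : coercive (invmx M + D) l).

(** The matrix [W], with [M] in the role of [S_t] and [D] in that of [D_0]. *)
Definition resolvent := invmx (invmx M + D).

Let Tu : invmx M + D \in unitmx.
Proof. exact: coercive_unit l0 MD. Qed.

Lemma resolvent_psd : psdmx resolvent.
Proof.
apply/pd_psd/pd_inv; apply: coercive_pd l0 MD.
by rewrite linearD /= Ds (invmx_sym Mp.1).
Qed.

Lemma resolvent_opbound : opbound resolvent l^-1.
Proof. exact: coercive_inv. Qed.

Lemma resolventE : 1%:M - D *m resolvent = invmx M *m resolvent.
Proof.
have := mulmxV Tu; rewrite mulmxDl -/resolvent => <-.
by rewrite addrK.
Qed.

Lemma resolvent_solve X E : X *m (1%:M + D *m M) = E ->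
  X = E *m (1%:M - D *m resolvent).
Proof.
have Mu := pd_unit Mp.
move=> <-; rewrite resolventE -!mulmxA [_ *m (invmx M *m _)]mulmxA.
have -> : (1%:M + D *m M) *m invmx M = invmx M + D.
  by rewrite mulmxDl mul1mx -mulmxA mulmxV // mulmx1.
by rewrite mulmxV // mulmx1.
Qed.

(** Both sides equal [M^-1 W D]. As [W] is psd, the left form is at most [D] and the right one at
    most [M^-1], which no longer involves [Q]. *)
Lemma resolvent_sandwich : D - D *m resolvent *m D =
  invmx M - invmx M *m resolvent *m invmx M.
Proof.
have e1 : D - D *m resolvent *m D = invmx M *m resolvent *m D.
  by rewrite -resolventE mulmxBl mul1mx.
have e2 : invmx M *m resolvent *m (invmx M + D) = invmx M.
  by rewrite -mulmxA mulVmx // mulmx1.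
by apply/eqP; rewrite e1 eq_sym subr_eq addrC -mulmxDr e2.
Qed.

End Resolvent.

Section Flow.
Variables (A R S P G : 'M[K]_r) (c : K).
Local Notation B := (A - P *m S).
Local Notation N := (invmx G - P).
Local Notation e t := (expmx (t *: B)).
Local Notation l := (lambda_min N).
Local Notation g t := (gram B G t).
Hypotheses (r0 : (0 < r)%N) (Sp : psdmx S) (Pp : pdmx P).
Hypotheses (Peq : riccati A R S P = 0) (BG : B^T *m G + G *m B = - S).
Hypotheses (Gp : pdmx G) (Np : pdmx N).
Hypothesis gp : forall t : K, 0 < t -> pdmx (g t).
Hypothesis gG : forall (t : K) x, 0 <= t -> vdot x (g t *m x) <= vdot x (G *m x).
Hypothesis gmon : forall (s t : K) x, 0 <= s -> s <= t ->
  vdot x (g s *m x) <= vdot x (g t *m x).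
Hypotheses (c1 : 1 <= c) (ec : forall t : K, 0 <= t -> opbound (e t) c).
Variables (phi : K -> 'M[K]_r -> 'M[K]_r) (E : K -> K -> 'M[K]_r -> 'M[K]_r).
Hypotheses (phiP : is_riccati_flow A R S phi) (EP : is_exp_semigroup A S phi E).

Let c0 : 0 <= c. Proof. exact: le_trans ler01 c1. Qed.
Let l0 : 0 < l. Proof. exact: lambda_min_gt0. Qed.

Lemma phi_psd s Q : 0 <= s -> psdmx Q -> psdmx (phi s Q).
Proof. by move=> s0 Qp; have [_ /(_ s s0) []] := phiP Qp. Qed.

Lemma phi_traj s Q : 0 <= s -> psdmx Q ->
  traj (fun u => phi (s + u) Q - P)
    (fun u => B *m (phi (s + u) Q - P) + (phi (s + u) Q - P) *m B^T
      - (phi (s + u) Q - P) *m S *m (phi (s + u) Q - P)).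
Proof.
move=> s0 Qp.
have T : traj (fun u => phi (s + u) Q) (fun u => riccati A R S (phi (s + u) Q)).
  apply: has_derivative_traj => u u0; apply: (@has_derivative_shift _ _ (phi^~ Q) _ _ _ _ s0).
  by have [_ /(_ (s + u) (addr_ge0 s0 u0)) []] := phiP Qp.
apply: traj_eq (trajB T (traj_cst P)) => u _.
by rewrite subr0 (riccati_shift _ Pp.1 Sp.1 Peq).
Qed.

Lemma E_traj s Q : 0 <= s -> psdmx Q ->
  traj (fun u => E s (s + u) Q)
    (fun u => (B - (phi (s + u) Q - P) *m S) *m E s (s + u) Q).
Proof.
move=> s0 Qp.
have T : traj (fun u => E s (s + u) Q) (fun u => (A - phi (s + u) Q *m S) *m E s (s + u) Q).
  apply: has_derivative_traj => u u0.
  apply: (@has_derivative_shift _ _ ((E s)^~ Q) _ _ _ _ (lexx s)).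
  by have [_] := EP Qp s0; apply; rewrite lerDl.
apply: traj_eq T => u _; congr (_ *m _).
by rewrite mulmxBl opprB addrA subrK.
Qed.

Lemma E_init s Q : 0 <= s -> psdmx Q -> E s (s + 0) Q = 1%:M.
Proof. by move=> s0 Qp; rewrite addr0; have [] := EP Qp s0. Qed.

Lemma E_floquet s t Q : 0 <= s -> 0 <= t -> psdmx Q ->
  E s (s + t) Q *m (1%:M + (phi s Q - P) *m g t) = e t.
Proof.
move=> s0 t0 Qp.
have := floquet BG (phi_traj s0 Qp) (E_traj s0 Qp) (E_init s0 Qp) t0.
by rewrite addr0.
Qed.

Lemma phi_floquet t Q : 0 <= t -> psdmx Q ->
  phi t Q - P = E 0 t Q *m (Q - P) *m (e t)^T.
Proof.
move=> t0 Qp.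
have := floquet_flow BG (phi_traj (lexx 0) Qp) (E_traj (lexx 0) Qp)
  (E_init (lexx 0) Qp) t0.
by rewrite !add0r (phiP Qp).1.
Qed.

(** The representation at [Q = P], where [D_0 = 0]. *)
Lemma E_Pinf t : 0 <= t -> E 0 t P = e t.
Proof.
move=> t0; have := E_floquet (lexx 0) t0 (pd_psd Pp).
by rewrite (phiP (pd_psd Pp)).1 subrr mul0mx addr0 mulmx1 add0r.
Qed.

Lemma gram_resolvent_coercive t Q : 0 < t -> psdmx Q ->
  coercive (invmx (g t) + (Q - P)) l.
Proof.
move=> t0 Qp x; apply: le_trans (lambda_min_coercive r0 Np.1 x) _.
rewrite !mulmxDl !mulNmx !vdotDr !vdotNr.
have := pd_inv_le (gp t0) Gp (fun x => gG x (ltW t0)) x.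
by have := psd_vdot_ge0 x Qp; lra.
Qed.

Local Notation res t Q := (resolvent (g t) (Q - P)).

Lemma sub_sym Q : psdmx Q -> (Q - P)^T = Q - P.
Proof. by move=> Qp; rewrite trmx_sub Qp.1 Pp.1. Qed.

Lemma spectral_norm_E_le s t Q b : 0 <= s -> 0 <= t -> psdmx Q ->
  opbound (phi s Q) b ->
  spectral_norm (E s (s + t) Q)
    <= (1 + (b + spectral_norm P) / l) * spectral_norm (e t).
Proof.
move=> s0 t0 Qp phib; have p0 := spectral_norm_ge0 P; have b0 : 0 <= b.
  have := phib (delta_mx (Ordinal r0) 0); move/(le_trans (eucl_norm_ge0 _)).
  rewrite pmulr_lge0 // eucl_norm_gt0; apply/eqP => /matrixP/(_ (Ordinal r0) 0).
  by rewrite !mxE !eqxx => /eqP; rewrite oner_eq0.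
have q0 : 0 <= (b + spectral_norm P) / l by rewrite divr_ge0 ?addr_ge0 ?(ltW l0).
(* [S_0 = 0] has no inverse, but at [t = 0] the semigroup is the identity and the constant is at
   least 1. *)
move: t0; rewrite le_eqVlt => /predU1P[<-|t0].
  rewrite scale0r expmx0 E_init // ler_peMl ?spectral_norm_ge0 //; lra.
have Dp := phi_psd s0 Qp.
have co := gram_resolvent_coercive t0 Dp.
rewrite (resolvent_solve (gp t0) l0 co (E_floquet s0 (ltW t0) Qp)).
apply: le_trans (spectral_normM _ _) _; rewrite mulrC ler_wpM2r ?spectral_norm_ge0 //.
apply: spectral_norm_le; first by lra.
apply: opboundD; first exact: opbound1.
apply/opboundN/opboundM; first by lra.
  by apply: opboundD => //; apply/opboundN/opbound_spectral_norm.
exact: resolvent_opbound l0 co.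
Qed.

(** The two factors of [chi]: [S_t >= S_d] bounds [S_t^-1] by the inverse of [lambda_min (g d)], and
    [W] is bounded by the inverse of [l]. *)
Lemma spectral_norm_E_chi s t d Q : 0 <= s -> 0 < d -> d <= t -> psdmx Q ->
  spectral_norm (E s (s + t) Q) <= (lambda_min (g d) * l)^-1 * spectral_norm (e t).
Proof.
move=> s0 d0 dt Qp; have t0 := lt_le_trans d0 dt.
have co := gram_resolvent_coercive t0 (phi_psd s0 Qp).
have ld0 : 0 < lambda_min (g d) by exact: lambda_min_gt0 (gp d0).
rewrite (resolvent_solve (gp t0) l0 co (E_floquet s0 (ltW t0) Qp)).
apply: le_trans (spectral_normM _ _) _; rewrite mulrC ler_wpM2r ?spectral_norm_ge0 //.
rewrite (resolventE l0 co) invfM; apply: spectral_norm_le.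
  by apply: mulr_ge0; rewrite invr_ge0; [exact: (ltW ld0) | exact: (ltW l0)].
apply: opboundM; first by rewrite invr_ge0 (ltW ld0).
  apply: (coercive_inv ld0) => x.
  exact: le_trans (lambda_min_coercive r0 (gp d0).1 x) (gmon x (ltW d0) dt).
exact: resolvent_opbound l0 co.
Qed.

(** Since the flow is psd, an upper bound on the quadratic form of [X] alone controls its norm. *)
Lemma phi_quad_le t Q X b : 0 <= b -> 0 <= t -> psdmx Q ->
  phi t Q - P = e t *m X *m (e t)^T ->
  (forall y, vdot y (X *m y) <= b * vdot y y) ->
  opbound (phi t Q) (spectral_norm P + b * c ^+ 2).
Proof.
move=> b0 t0 Qp phiX Xb.
apply: psd_opbound (phi_psd t0 Qp) _.
  by rewrite addr_ge0 ?spectral_norm_ge0 // mulr_ge0 // exprn_ge0.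
move=> y; rewrite -[phi t Q](subrK P) phiX mulmxDl vdotDr mulrDl addrC.
apply: lerD; first exact/vdot_opbound/opbound_spectral_norm.
rewrite -!mulmxA vdot_mulmx; apply: le_trans (Xb _) _.
rewrite -mulrA ler_wpM2l //.
have := opbound_tr c0 (ec t0) y.
by rewrite eucl_norm_le ?mulr_ge0 ?eucl_norm_ge0 // exprMn sqr_eucl_norm.
Qed.

Lemma phi_opbound t Q : 0 <= t -> psdmx Q ->
  opbound (phi t Q) (spectral_norm P + spectral_norm Q * c ^+ 2).
Proof.
move=> t0 Qp; have QP y : vdot y ((Q - P) *m y) <= spectral_norm Q * vdot y y.
  rewrite mulmxBl vdotBr.
  have := vdot_opbound y (opbound_spectral_norm Q).
  by have := psd_vdot_ge0 y (pd_psd Pp); lra.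
move: (t0); rewrite le_eqVlt => /predU1P[t00|tp].
  apply: (phi_quad_le (X := Q - P)) => //; first exact: spectral_norm_ge0.
  by rewrite -t00 (phiP Qp).1 scale0r expmx0 trmx1 mul1mx mulmx1.
have co := gram_resolvent_coercive tp Qp.
have Ef := E_floquet (lexx 0) t0 Qp; rewrite add0r (phiP Qp).1 in Ef.
apply: (phi_quad_le (X := (Q - P) - (Q - P) *m res t Q *m (Q - P))) => //.
- exact: spectral_norm_ge0.
- rewrite phi_floquet // (resolvent_solve (gp tp) l0 co Ef).
  by rewrite -[_ *m _ *m (Q - P)]mulmxA [(1%:M - _) *m _]mulmxBl mul1mx.
- move=> y; rewrite mulmxBl vdotBr; apply: le_trans (QP y).
  rewrite gerBl -!mulmxA vdot_mulmx sub_sym //.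
  exact/psd_vdot_ge0/(resolvent_psd (gp tp) (sub_sym Qp) l0 co).
Qed.

Lemma phi_opbound_unif d t Q : 0 < d -> d <= t -> psdmx Q ->
  opbound (phi t Q) (spectral_norm P + (lambda_min (g d))^-1 * c ^+ 2).
Proof.
move=> d0 dt Qp; have tp := lt_le_trans d0 dt.
have ld0 : 0 < lambda_min (g d) by exact: lambda_min_gt0 (gp d0).
have co := gram_resolvent_coercive tp Qp.
have Ef := E_floquet (lexx 0) (ltW tp) Qp; rewrite add0r (phiP Qp).1 in Ef.
have invg : opbound (invmx (g t)) (lambda_min (g d))^-1.
  apply: (coercive_inv ld0) => x.
  exact: le_trans (lambda_min_coercive r0 (gp d0).1 x) (gmon x (ltW d0) dt).
apply: (phi_quad_le (X := (Q - P) - (Q - P) *m res t Q *m (Q - P))) => //.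
- by rewrite invr_ge0 (ltW ld0).
- exact: ltW.
- rewrite phi_floquet ?ltW // (resolvent_solve (gp tp) l0 co Ef).
  by rewrite -[_ *m _ *m (Q - P)]mulmxA [(1%:M - _) *m _]mulmxBl mul1mx.
- move=> y; rewrite (resolvent_sandwich l0 co) mulmxBl vdotBr.
  apply: le_trans (vdot_opbound y invg); rewrite gerBl -!mulmxA vdot_mulmx.
  rewrite (invmx_sym (gp tp).1).
  exact/psd_vdot_ge0/(resolvent_psd (gp tp) (sub_sym Qp) l0 co).
Qed.

End Flow.
End Estimates.

Theorem corollary3p1 (K : realType) (r : nat) (A R S rootR rootS : 'M[K]_r) :
  (1 <= r)%N -> psdmx R -> psdmx S ->
  rootR^T = rootR -> rootR *m rootR = R ->
  rootS^T = rootS -> rootS *m rootS = S ->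
  observable A rootS -> controllable A rootR ->
  exists (c : K) (c_ : K -> K),
    forall (Pinf : 'M[K]_r) (phi : K -> 'M[K]_r -> 'M[K]_r)
           (E : K -> K -> 'M[K]_r -> 'M[K]_r),
    is_riccati_fixpoint A R S Pinf ->
    is_riccati_flow A R S phi ->
    is_exp_semigroup A S phi E ->
    (forall (s t : K) (Q : 'M[K]_r), 0 <= s -> 0 <= t -> psdmx Q ->
       spectral_norm (E s (s + t) Q)
         <= c * (1 + spectral_norm Q) * spectral_norm (E 0 t Pinf))
    /\
    (forall delta s t : K, 0 < delta -> delta <= s -> 0 <= t ->
       (ereal_sup [set (spectral_norm (E s (s + t) Q))%:E | Q in @psdmx K r]
          <= (c_ delta * spectral_norm (E 0 t Pinf))%:E)%E
       /\
       (ereal_sup [set (spectral_norm (E t (t + s) Q))%:E | Q in @psdmx K r]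
          <= (chi A S Pinf delta * spectral_norm (E 0 s Pinf))%:E)%E).
Proof.
move=> r0 Rp Sp rr rR rs rS obs ctr.
(* The constants must be named before [Pinf]; if there is no fixed point, any constants do. *)
have [[P Pfix]|noP] := pselect (exists P, is_riccati_fixpoint A R S P); last first.
  by exists 0, (fun=> 0) => Pinf phi E Pfix; case: noP; exists Pinf.
have [Pp Peq Ph] := Pfix; pose B := A - P *m S.
have Bs : stable B by exact: hurwitz_cvg0.
have [G BG] := lyapunov_solution (- S) Bs.
have obsB (y : 'cV[K]_r) : (forall k, S *m B ^+ k *m y = 0) -> y = 0.
  exact: (observable_closed_loop (P := P) rs rS obs).
have Gp : pdmx G := lyapunov_pd Bs Sp BG obsB.
have Np : pdmx (invmx G - P) := Pinfty_minus_pd Rp Sp rr rR ctr Pp Peq Bs BG Gp.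
have gp (t : K) : 0 < t -> pdmx (gram B G t) := gram_pd Bs Sp BG obsB (t := t).
have gG (t : K) x : 0 <= t -> vdot x (gram B G t *m x) <= vdot x (G *m x).
  exact: (gram_le_lyapunov Bs Sp BG).
have gmon (s t : K) x : 0 <= s -> s <= t ->
    vdot x (gram B G s *m x) <= vdot x (gram B G t *m x).
  exact: (gram_le Sp BG).
have [c c1 ec] := stable_bounded Bs.
have c0 : 0 <= c := le_trans ler01 c1.
set l := lambda_min (invmx G - P).
have l0 : 0 < l by exact: lambda_min_gt0.
set p := spectral_norm P.
have p0 : 0 <= p := spectral_norm_ge0 P.
(* Both constants come from [1 + (b + p) / l], where [b] bounds the flow: by [phi_opbound] here,
   coarsened to factor out [1 + |Q|], and by [phi_opbound_unif] in the next one. *)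
exists (1 + 2 * p / l + c ^+ 2 / l).
exists (fun d => 1 + (p + (lambda_min (gram B G d))^-1 * c ^+ 2 + p) / l).
move=> Pinf phi E Pinffix phiP EP.
have -> : Pinf = P by exact: riccati_fixpoint_unique Sp Pinffix Pfix.
have EPinf t : 0 <= t -> E 0 t P = expmx (t *: B) by exact: (E_Pinf Sp Pp Peq BG phiP EP).
split=> [s t Q s0 t0 Qp|d s t d0 ds t0].
  rewrite EPinf //.
  have := phi_opbound r0 Sp Pp Peq BG Gp Np gp gG c1 ec phiP EP s0 Qp.
  move=> /(spectral_norm_E_le r0 Sp Pp Peq BG Gp Np gp gG phiP EP s0 t0 Qp).
  move/le_trans; apply; rewrite ler_wpM2r ?spectral_norm_ge0 //.
  rewrite -/p -/l; have q0 := spectral_norm_ge0 Q; rewrite -subr_ge0.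
  have -> : (1 + 2 * p / l + c ^+ 2 / l) * (1 + spectral_norm Q) -
      (1 + (p + spectral_norm Q * c ^+ 2 + p) / l) =
      spectral_norm Q * (1 + 2 * p / l) + c ^+ 2 / l.
    by field; rewrite gt_eqF.
  by rewrite addr_ge0 ?mulr_ge0 ?addr_ge0 ?mulr_ge0 ?invr_ge0 ?(ltW l0) // exprn_ge0.
have s0 := le_trans (ltW d0) ds.
split; apply: ge_ereal_sup => _ [Q Qp <-]; rewrite lee_fin EPinf //.
  have := phi_opbound_unif r0 Sp Pp Peq BG Gp Np gp gG gmon c1 ec phiP EP d0 ds Qp.
  exact: (spectral_norm_E_le r0 Sp Pp Peq BG Gp Np gp gG phiP EP s0 t0 Qp).
rewrite /chi /Pinfty_minus (gramian_inftyE Bs BG) opprB (gramianE BG (ltW d0)).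
exact: (spectral_norm_E_chi r0 Sp Pp Peq BG Gp Np gp gG gmon phiP EP t0 d0 ds Qp).
Qed.
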